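(* (Path length bound.) Let $d\ge1$, $G>0$, and run the anytime Haar OLR algorithm described in the context. Then for all $T\in\mathbb{N}_+$ and all comparators $u_{1:T}=(u_1,\ldots,u_T)\in(\mathbb{R}^d)^T$, $$\mathrm{Reg}_T(u_{1:T})\le \tilde O\Big(\|\bar u\|_2\sqrt T+\sqrt{P\bar S}\Big),$$ where $\bar u=\frac1T\sum_{t=1}^T u_t$, $P=\sum_{t=1}^{T-1}\|u_{t+1}-u_t\|_2$, $\bar S=\sum_{t=1}^T\|u_t-\bar u\|_2$, and $\tilde O$ hides constant factors (possibly depending on $G$) and factors poly-logarithmic in $T$ and $\max_t\|u_t\|_2$.
   Context: Online convex optimization game: in each round $t$ the player picks $x_t\in\mathbb{R}^d$; an adversarial environment reveals a convex, $G$-Lipschitz (w.r.t. $\|\cdot\|_2$) loss $l_t$, possibly depending on $x_1,\ldots,x_t$; the player observes $g_t\in\partial l_t(x_t)$. Unconstrained dynamic regret: $\mathrm{Reg}_T(u_{1:T})=\sup_{\text{environments}}[\sum_{t=1}^T l_t(x_t)-\sum_{t=1}^T l_t(u_t)]$. Haar dictionary for horizon $T=2^m$: for scale $j\in[1:m]$ and location $l\in[1:2^{-j}T]$, $h^{(j,l)}\in\mathbb{R}^T$ has $t$-th entry $1$ for $t\in[2^j(l-1)+1:2^j(l-1)+2^{j-1}]$, $-1$ for $t\in[2^j(l-1)+2^{j-1}+1:2^jl]$, and $0$ otherwise; together with the all-one vector $h^*$ these $N=T$ vectors form the columns of a $T\times T$ matrix; write its $t$-th row as $(h_{t,1},\ldots,h_{t,N})$,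 $h_{t,n}\in\mathbb{R}$. FreeGrad (dimension $d$, hyperparameter $\varepsilon'>0$, Lipschitz constant $\hat G=G$): initialize $s=0\in\mathbb{R}^d$, $v=\hat G^2$; each round predict $\hat x=-\varepsilon' s\cdot\frac{(2v+\hat G\|s\|_2)\hat G^2}{2(v+\hat G\|s\|_2)^2\sqrt v}\exp\!\big(\frac{\|s\|_2^2}{2v+2\hat G\|s\|_2}\big)$, then observe $\hat g$ and update $s\leftarrow s+\hat g$, $v\leftarrow v+\|\hat g\|_2^2$. Fixed-horizon Haar OLR (horizon $T=2^m$, hyperparameter $\varepsilon$): run $N=T$ copies $\mathcal{A}_n$ of $d$-dimensional FreeGrad with hyperparameter $\varepsilon/N$. In round $t$: for each $n$ with $h_{t,n}\ne0$ query $\mathcal{A}_n$ for $\hat x_{t,n}\in\mathbb{R}^d$ (otherwise arbitrary), set $w_{t,n}=h_{t,n}\hat x_{t,n}$, predict $x_t=\sum_n w_{t,n}$; after receiving $g_t$, for each $n$ with $h_{t,n}\ne0$ send $h_{t,n}g_t$ to $\mathcal{A}_n$. Anytime Haar OLR: for $m=1,2,\ldots$, run a fresh copy of fixed-horizon Haar OLR with horizon $2^m$ and $\varepsilon=1$ for $2^m$ rounds.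
   Formalization: The bound is proved as C·polylog·(1+‖ū‖√T+√(P S̄)), with an additive constant 1 inside Õ; without it the claim fails, since for u=0 the right side is 0 while the regret can be positive. *)

(* Defs.v *)
From HB Require Import structures.
From mathcomp Require Import all_boot all_order all_algebra.
From mathcomp Require Import all_classical all_reals all_analysis.
Set Implicit Arguments. Unset Strict Implicit. Unset Printing Implicit Defensive.
Import Order.TTheory GRing.Theory Num.Theory.
Local Open Scope ring_scope.

Section Defs.
Variable R : realType.

Definition dotv {d : nat} (x y : 'rV[R]_d) : R := \sum_(i < d) x ord0 i * y ord0 i.
Definition norm2 {d : nat} (x : 'rV[R]_d) : R := Num.sqrt (\sum_(i < d) x ord0 i ^+ 2).

Definition convex_fun {d : nat} (f : 'rV[R]_d -> R) : Prop :=
  forall (x y : 'rV[R]_d) (lam : R), 0 <= lam -> lam <= 1 ->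
    f (lam *: x + (1 - lam) *: y) <= lam * f x + (1 - lam) * f y.
Definition lipschitz_fun {d : nat} (G : R) (f : 'rV[R]_d -> R) : Prop :=
  forall x y : 'rV[R]_d, `|f x - f y| <= G * norm2 (x - y).
Definition subgradient {d : nat} (f : 'rV[R]_d -> R) (x g : 'rV[R]_d) : Prop :=
  forall y : 'rV[R]_d, f x + dotv g (y - x) <= f y.

Definition freegrad_pred {d : nat} (eps' Gh : R) (s : 'rV[R]_d) (v : R) : 'rV[R]_d :=
  let ns := norm2 s in
  (- eps' * ((2 * v + Gh * ns) * Gh ^+ 2)
     / (2 * (v + Gh * ns) ^+ 2 * Num.sqrt v)
     * expR (ns ^+ 2 / (2 * v + 2 * Gh * ns))) *: s.

Definition haar_h (j l t : nat) : R :=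
  let a := (2 ^ j * (l - 1))%N in
  if ((a < t) && (t <= a + 2 ^ (j - 1)))%N then 1
  else if ((a + 2 ^ (j - 1) < t) && (t <= 2 ^ j * l))%N then -1
  else 0.

(* the N = T = 2^m columns of the Haar dictionary: h^* and all h^(j,l) *)
Definition haar_cols (m : nat) : seq (nat -> R) :=
  (fun _ => 1) ::
  [seq haar_h jl.1 jl.2 | jl <- [seq (j, l) | j <- iota 1 m, l <- iota 1 (2 ^ (m - j))]].

(* Fixed-horizon Haar OLR, horizon 2^m, hyperparameter eps: prediction in local
   round tau (1-based) given the gradients g 1, ..., g (tau-1).
   Copy n (column h) has seen h tau' * g tau' for tau' < tau with h tau' <> 0;
   the terms with h tau' = 0 contribute 0 to s and v, so summing over all tau' < tau
   gives exactly the FreeGrad state. *)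
Definition haar_fixed_pred {d : nat} (m : nat) (eps Gh : R) (g : nat -> 'rV[R]_d)
    (tau : nat) : 'rV[R]_d :=
  \sum_(h <- haar_cols m)
    h tau *: freegrad_pred (eps / (2 ^ m)%N%:R) Gh
      (\sum_(1 <= tau' < tau) h tau' *: g tau')
      (Gh ^+ 2 + \sum_(1 <= tau' < tau) norm2 (h tau' *: g tau') ^+ 2).

(* Anytime Haar OLR with eps = 1: global round t >= 1 lies in epoch
   m = floor(log2 (t+1)) >= 1 (epoch m covers rounds 2^m - 1 .. 2^(m+1) - 2),
   at local round t + 2 - 2^m; the fresh copy only sees the epoch's gradients. *)
Definition epoch (t : nat) : nat := trunc_log 2 t.+1.
Definition anytime_pred {d : nat} (Gh : R) (g : nat -> 'rV[R]_d) (t : nat) : 'rV[R]_d :=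
  let m := epoch t in
  haar_fixed_pred m 1 Gh (fun tau => g (tau + 2 ^ m - 2)%N) (t + 2 - 2 ^ m)%N.

Definition admissible_env {d : nat} (G : R) (l : nat -> 'rV[R]_d -> R)
    (g : nat -> 'rV[R]_d) (T : nat) : Prop :=
  forall t : nat, (1 <= t <= T)%N ->
    convex_fun (l t) /\ lipschitz_fun G (l t) /\
    subgradient (l t) (anytime_pred G g t) (g t).

Definition env_regret {d : nat} (G : R) (l : nat -> 'rV[R]_d -> R)
    (g : nat -> 'rV[R]_d) (T : nat) (u : nat -> 'rV[R]_d) : R :=
  \sum_(1 <= t < T.+1) (l t (anytime_pred G g t) - l t (u t)).

Definition ubar {d : nat} (T : nat) (u : nat -> 'rV[R]_d) : 'rV[R]_d :=
  (T%:R)^-1 *: \sum_(1 <= t < T.+1) u t.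
Definition path_len {d : nat} (T : nat) (u : nat -> 'rV[R]_d) : R :=
  \sum_(1 <= t < T) norm2 (u t.+1 - u t).
Definition Sbar {d : nat} (T : nat) (u : nat -> 'rV[R]_d) : R :=
  \sum_(1 <= t < T.+1) norm2 (u t - ubar T u).
Definition umax {d : nat} (T : nat) (u : nat -> 'rV[R]_d) : R :=
  \big[Num.max/0]_(1 <= t < T.+1) norm2 (u t).

Definition polylog (k : nat) (T : nat) (M : R) : R :=
  (1 + ln (1 + T%:R) + ln (1 + M)) ^+ k.

End Defs.

(* Main.v *)
Require Import Defs.
From HB Require Import structures.
From mathcomp Require Import all_boot all_order all_algebra.
From mathcomp Require Import all_classical all_reals all_analysis.
From mathcomp Require Import ring lra zify.
Import Order.TTheory GRing.Theory Num.Theory.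
Import numFieldNormedType.Exports.
Local Open Scope ring_scope.
Set Implicit Arguments. Unset Strict Implicit. Unset Printing Implicit Defensive.

(** After dividing gradients by [G], FreeGrad predicts minus the [s]-gradient of
    the potential [eps' exp(|s|^2 / (2v + 2|s|)) / sqrt v].  A step [(s, v) ->
    (s + g, v + |g|^2)] with [|g| <= 1] keeps the potential below its linear
    approximation in [g]: the component of [g] orthogonal to [s] is harmless,
    and for the parallel component, after taking logarithms, everything reduces
    to rational inequalities in [|s|], [v] and the length of that component.
    The potential therefore telescopes, and a copy of FreeGrad has regret
    [eps' + O~(|u| sqrt V)] against a fixed [u].

    On an epoch of length [2^m] expand the comparator in the Haar dictionary.  A
    coefficient on a block [I] of length [2^j] is at most the path length [P_I]
    of the comparator on [I], and at most [2^-j S_I], where [S_I] is the sum of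
    the distances to any fixed centre.  Hence [|coefficient| sqrt(2^j) <=
    sqrt(P_I S_I)], and Cauchy-Schwarz over the blocks of one scale gives
    [sqrt(P S)]; there are only logarithmically many scales and epochs.  The
    centre is the global mean, which is also used to pad the comparator to the
    end of the last epoch. *)

(** * Inner product and Euclidean norm on row vectors *)

Section Euclidean.
Context {R : realType} {d : nat}.
Implicit Types (x y z : 'rV[R]_d) (a : R).

Lemma dotvC x y : dotv x y = dotv y x.
Proof. by apply: eq_bigr => i _; rewrite mulrC. Qed.

Lemma dotvDr x y z : dotv x (y + z) = dotv x y + dotv x z.
Proof. by rewrite /dotv -big_split; apply: eq_bigr => i _; rewrite mxE mulrDr. Qed.

Lemma dotvZr a x y : dotv x (a *: y) = a * dotv x y.
Proof. by rewrite /dotv mulr_sumr; apply: eq_bigr => i _; rewrite mxE mulrCA. Qed.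

Lemma dotvDl x y z : dotv (x + y) z = dotv x z + dotv y z.
Proof. by rewrite !(dotvC _ z) dotvDr. Qed.

Lemma dotvZl a x y : dotv (a *: x) y = a * dotv x y.
Proof. by rewrite !(dotvC _ y) dotvZr. Qed.

Lemma dotvBr x y z : dotv x (y - z) = dotv x y - dotv x z.
Proof. by rewrite dotvDr -scaleN1r dotvZr mulN1r. Qed.

Lemma dot0v x : dotv 0 x = 0.
Proof. by rewrite -(scale0r 0) dotvZl mul0r. Qed.

Lemma dotv0 x : dotv x 0 = 0.
Proof. by rewrite dotvC dot0v. Qed.

Lemma dotv_sumr I (r : seq I) (P : pred I) x (F : I -> 'rV[R]_d) :
  dotv x (\sum_(i <- r | P i) F i) = \sum_(i <- r | P i) dotv x (F i).
Proof. exact: (big_morph (dotv x) (dotvDr x) (dotv0 x)). Qed.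

Lemma norm2_ge0 x : 0 <= norm2 x.
Proof. exact: sqrtr_ge0. Qed.

Lemma norm2_sqr x : norm2 x ^+ 2 = dotv x x.
Proof.
by rewrite sqr_sqrtr; [apply: eq_bigr => i _ | apply: sumr_ge0 => i _; exact: sqr_ge0].
Qed.

Lemma norm2_0 : norm2 (0 : 'rV[R]_d) = 0.
Proof.
by rewrite /norm2 big1 ?sqrtr0 // => i _; rewrite mxE expr0n.
Qed.

Lemma norm2Z a x : norm2 (a *: x) = `|a| * norm2 x.
Proof.
apply/eqP; rewrite -(@eqrXn2 _ 2) ?mulr_ge0 ?norm2_ge0 //.
by rewrite exprMn !norm2_sqr dotvZl dotvZr mulrA real_normK ?num_real // expr2.
Qed.

Lemma norm2N x : norm2 (- x) = norm2 x.
Proof. by rewrite -scaleN1r norm2Z normrN1 mul1r. Qed.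

Lemma norm2_distC x y : norm2 (x - y) = norm2 (y - x).
Proof. by rewrite -norm2N opprB. Qed.

Lemma dotv_sqr_le x y : dotv x y ^+ 2 <= dotv x x * dotv y y.
Proof.
have sq t : 0 <= dotv x x - 2 * t * dotv x y + t ^+ 2 * dotv y y.
  have := sqr_ge0 (norm2 (x - t *: y)).
  rewrite norm2_sqr dotvBr !(dotvC (x - _)) !dotvBr !dotvZr !dotvZl (dotvC y x).
  lra.
have xx : 0 <= dotv x x by rewrite -norm2_sqr sqr_ge0.
have [y0|yN0] := eqVneq (dotv y y) 0.
  have [->|c0] := eqVneq (dotv x y) 0; first by rewrite y0 mulr0 expr0n.
  (* For [dotv y y = 0] the quadratic in [t] is affine; at this [t] it equals -1, a
     contradiction. *)
  have := sq ((1 + dotv x x) / (2 * dotv x y)); rewrite y0 mulr0 addr0.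
  suff -> : 2 * ((1 + dotv x x) / (2 * dotv x y)) * dotv x y = 1 + dotv x x by lra.
  by field.
have yy : 0 < dotv y y by rewrite lt_def yN0 -norm2_sqr sqr_ge0.
have yV : 0 < (dotv y y)^-1 by rewrite invr_gt0.
rewrite -subr_ge0 -(pmulr_rge0 _ yV).
have := sq (dotv x y / dotv y y).
by congr (0 <= _); field.
Qed.

Lemma dotv_le x y : `|dotv x y| <= norm2 x * norm2 y.
Proof.
rewrite -(@ler_pXn2r _ 2) ?nnegrE ?mulr_ge0 ?norm2_ge0 //.
by rewrite real_normK ?num_real // exprMn !norm2_sqr dotv_sqr_le.
Qed.

Lemma norm2_sqrD x y :
  norm2 (x + y) ^+ 2 = norm2 x ^+ 2 + 2 * dotv x y + norm2 y ^+ 2.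
Proof. rewrite !norm2_sqr dotvDr !dotvDl (dotvC y x); ring. Qed.

Lemma norm2D x y : norm2 (x + y) <= norm2 x + norm2 y.
Proof.
rewrite -(@ler_pXn2r _ 2) ?nnegrE ?addr_ge0 ?norm2_ge0 // norm2_sqrD sqrrD.
have := le_trans (ler_norm _) (dotv_le x y); rewrite -mulr_natl; lra.
Qed.

Lemma norm2_sum I (r : seq I) (P : pred I) (F : I -> 'rV[R]_d) :
  norm2 (\sum_(i <- r | P i) F i) <= \sum_(i <- r | P i) norm2 (F i).
Proof.
elim/big_rec2: _ => [|i a x _ H]; first by rewrite norm2_0.
by rewrite (le_trans (norm2D _ _)) // lerD2l.
Qed.

End Euclidean.

(** * Lower bounds for the logarithm *)

Section LogBounds.
Context {R : realType}.
Implicit Types (x z : R).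

Lemma le_of_derive_ge0 (f df : R -> R) (b : R) : 0 <= b ->
  (forall y, 0 <= y <= b -> is_derive y 1 f (df y)) ->
  (forall y, 0 <= y <= b -> 0 <= df y) -> f 0 <= f b.
Proof.
move=> b0 fdf df0.
have [||y yb E] := @MVT_segment R f df 0 b b0.
- by move=> y; rewrite in_itv /= => /andP[y0 yb]; apply: fdf; rewrite !ltW.
- apply: derivable_within_continuous => y; rewrite in_itv /= => yb.
  exact: (@ex_derive _ _ _ _ _ _ _ (fdf y yb)).
- by rewrite -subr_ge0 E subr0 mulr_ge0 // df0.
Qed.

Lemma is_derive_ln_affine (k t : R) : 0 < 1 + t * k ->
  is_derive t 1 (fun u => ln (1 + u * k)) (k / (1 + t * k)).
Proof.
move=> p; have lin : is_derive t 1 (fun u => 1 + u * k) k.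
  by apply: is_derive_eq; rewrite /GRing.scale /=; ring.
rewrite [k / _]mulrC; exact: (@is_derive1_comp R (@ln R) _ t _ _ (is_derive1_ln p) lin).
Qed.

(** This rational bound reduces the logarithmic growth of [v] to polynomial arithmetic. Cleared of
    its denominator, the difference vanishes at 0, and its derivative is nonnegative because
    [ln y <= y - 1] at [y = 1 / (1 + t)]. *)
Lemma ln1D_ge z : 0 <= z -> 2 * z / (2 + z) <= ln (1 + z).
Proof.
move=> z0.
pose f t : R := (2 + t) * ln (1 + t * 1) - 2 * t.
have : f 0 <= f z.
  apply: (@le_of_derive_ge0 f (fun t => ln (1 + t * 1) + (2 + t) / (1 + t * 1) - 2)) => //.
  - move=> t /andP[t0 _]; have t1 : 0 < 1 + t * 1 by lra.
    have dl := is_derive_ln_affine t1.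
    rewrite /f; apply: is_derive_eq.
    rewrite /GRing.scale /=; field; apply: lt0r_neq0; lra.
  - move=> t /andP[t0 _]; have t1 : 0 < 1 + t * 1 by lra.
    have tV : 0 < (1 + t * 1)^-1 by rewrite invr_gt0.
    have := @le_ln1Dx R ((1 + t * 1)^-1 - 1); rewrite addrCA subrr addr0 lnV ?posrE //.
    have -> : (2 + t) / (1 + t * 1) = 1 + (1 + t * 1)^-1 by field; apply: lt0r_neq0; lra.
    lra.
rewrite /f mul0r !addr0 ln1 !mulr0 subr0 mulr1 => H.
by rewrite ler_pdivrMr; lra.
Qed.

(* For x = -1 this is exp(- lam) <= 1 - lam + lam^2/2, the tight case. *)
Lemma ln1D_quadratic_ge (lam x : R) : 0 <= lam <= 1 -> -1 <= x <= 1 ->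
  x * (lam - lam ^+ 2 / 2) - x ^+ 2 * lam ^+ 2 / 2 <=
  ln (1 + x * (lam - lam ^+ 2 / 2)).
Proof.
move=> /andP[l0 l1] /andP[xN1 x1]; set eta := lam - _ / 2.
have e0 : 0 <= eta by rewrite /eta; nra.
have e1 : eta <= 1 / 2 by rewrite /eta; nra.
(* Here [x] is replaced by [t * x] with [t] running from 0 to 1, which treats both signs of [x] at
   once. *)
pose f t : R := ln (1 + t * (x * eta)) - t * (x * eta) + t ^+ 2 * (x ^+ 2 * lam ^+ 2 / 2).
have pos t : 0 <= t <= 1 -> 1 - eta <= 1 + t * (x * eta).
  move=> /andP[t0 t1]; have : -1 <= t * x by nra.
  nra.
have : f 0 <= f 1.
  apply: (@le_of_derive_ge0 f
    (fun t => t * x ^+ 2 * (lam ^+ 2 - eta ^+ 2 / (1 + t * (x * eta))))) => //.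
  - move=> t t01; have := pos t t01 => p; have p0 : 0 < 1 + t * (x * eta) by lra.
    have dl := is_derive_ln_affine p0.
    rewrite /f; apply: is_derive_eq.
    rewrite /GRing.scale /=; field; apply: lt0r_neq0; lra.
  - move=> t t01; have := pos t t01 => p; have p0 : 0 < 1 + t * (x * eta) by lra.
    case/andP: t01 => t0 t1.
    apply: mulr_ge0; first by apply: mulr_ge0 => //; exact: sqr_ge0.
    rewrite subr_ge0 ler_pdivrMr //.
    apply: (@le_trans _ _ (lam ^+ 2 * (1 - eta))); last by rewrite ler_wpM2l ?sqr_ge0.
    have -> : eta ^+ 2 = lam ^+ 2 * (1 - lam / 2) ^+ 2 by rewrite /eta; field.
    by rewrite ler_wpM2l ?sqr_ge0 // /eta; nra.
rewrite /f !mul0r !addr0 ln1 expr0n expr1n !mul1r mul0r; lra.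
Qed.

End LogBounds.

(** * One-step inequality for the FreeGrad potential *)

Section Potential.
Context {R : realType}.

(* The two sides differ by
   x^2 (2 / (2 v + x^2) - (v - x n)^2 / ((v + n)^2 (v + x^2 + n + x))). *)
Lemma exponent_step_nneg (n v x : R) : 0 <= n -> 1 <= v -> -1 <= x <= 1 ->
  0 <= n + x ->
  (n + x) ^+ 2 / (v + x ^+ 2 + (n + x)) <=
    n ^+ 2 / (v + n) + 2 * x ^+ 2 / (2 * v + x ^+ 2)
    + (x * (2 * (n / (v + n)) - (n / (v + n)) ^+ 2) - x ^+ 2 * (n / (v + n)) ^+ 2).
Proof.
move=> n0 v1 /andP[xN1 x1] nx0.
have p0 : 0 < v + n by lra.
have x2 : 0 <= x ^+ 2 by exact: sqr_ge0.
have q0 : 0 < v + x ^+ 2 + (n + x) by lra.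
have k0 : 0 < 2 * v + x ^+ 2 by lra.
have key : (2 * v + x ^+ 2) * (v - x * n) ^+ 2 <=
    2 * ((v + n) ^+ 2 * (v + x ^+ 2 + (n + x))).
  case: (lerP 0 x) => x0.
    have h : (v - x * n) ^+ 2 <= (v + n) ^+ 2.
      by rewrite -subr_ge0 subr_sqr mulr_ge0 //; nra.
    have h0 := sqr_ge0 (v - x * n).
    by apply: (@le_trans _ _ ((2 * v + x ^+ 2) * (v + n) ^+ 2)); nra.
  (* The slack is [(1 + x) * (n + x)]. One factor [v - x * n] is compared with this quantity, the
     other with [v + n]. *)
  have h1 : v - x * n <= v + x ^+ 2 + (n + x) by nra.
  have h2 : v - x * n <= v + n by nra.
  have h3 : 0 <= v - x * n by nra.
  have h4 : 2 * v + x ^+ 2 <= 2 * (v + n) by nra.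
  have h5 : (2 * v + x ^+ 2) * (v - x * n) <= 2 * (v + n) * (v + n).
    by rewrite ler_pM // ltW.
  have -> : (2 * v + x ^+ 2) * (v - x * n) ^+ 2 =
    (2 * v + x ^+ 2) * (v - x * n) * (v - x * n) by ring.
  have -> : 2 * ((v + n) ^+ 2 * (v + x ^+ 2 + (n + x))) =
    2 * (v + n) * (v + n) * (v + x ^+ 2 + (n + x)) by ring.
  by rewrite ler_pM // mulr_ge0 // ltW.
rewrite -subr_ge0.
have -> : n ^+ 2 / (v + n) + 2 * x ^+ 2 / (2 * v + x ^+ 2)
    + (x * (2 * (n / (v + n)) - (n / (v + n)) ^+ 2) - x ^+ 2 * (n / (v + n)) ^+ 2)
    - (n + x) ^+ 2 / (v + x ^+ 2 + (n + x)) =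
  x ^+ 2 * (2 * ((v + n) ^+ 2 * (v + x ^+ 2 + (n + x))) -
    (2 * v + x ^+ 2) * (v - x * n) ^+ 2)
    / ((2 * v + x ^+ 2) * ((v + n) ^+ 2 * (v + x ^+ 2 + (n + x)))).
  by field; rewrite !lt0r_neq0.
rewrite divr_ge0 //; first by rewrite mulr_ge0 // subr_ge0.
by rewrite ltW // !mulr_gt0 // exprn_gt0.
Qed.

(** Here the gradient carries the sum across the origin. Writing [x = - (n + m)], the new length is
    [m], and [n + m <= 1] confines [n] and [m] to a bounded region. *)
Lemma exponent_step_neg (n v x : R) : 0 <= n -> 1 <= v -> -1 <= x <= 1 ->
  n + x <= 0 ->
  (n + x) ^+ 2 / (v + x ^+ 2 - (n + x)) <=
    n ^+ 2 / (v + n) + 2 * x ^+ 2 / (2 * v + x ^+ 2)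
    + (x * (2 * (n / (v + n)) - (n / (v + n)) ^+ 2) - x ^+ 2 * (n / (v + n)) ^+ 2).
Proof.
move=> n0 v1 /andP[xN1 x1] nx0.
have [m xE] : exists m, x = - (n + m) by exists (- (n + x)); ring.
have m0 : 0 <= m by lra.
have nm1 : n + m <= 1 by lra.
rewrite {}xE {x xN1 x1 nx0}.
have p0 : 0 < v + n by lra.
have r2 : 0 <= (n + m) ^+ 2 by exact: sqr_ge0.
rewrite sqrrN.
have -> : n + - (n + m) = - m by ring.
rewrite opprK sqrrN.
have q0 : 0 < v + (n + m) ^+ 2 + m by lra.
have k0 : 0 < 2 * v + (n + m) ^+ 2 by lra.
(* With all terms on one side, the claim is this inequality weakened by the nonnegative quantity in
   [e] below. *)
have key : n * (2 * m + n) / (v + n) + m ^+ 2 / (v + (n + m) ^+ 2 + m) <=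
    2 * (n + m) ^+ 2 / (2 * v + (n + m) ^+ 2).
  (* Over a common denominator the terms in [v^2] cancel and the numerator is [v * c1 + c0]. It is
     nonnegative since [v >= 1], [c1 >= n * m^2] and [c0 >= - n * m^2]. *)
  pose c1 := 2 * (n + m) ^+ 2 * n - (n + m) ^+ 4 + 2 * m ^+ 2 * (n + m) ^+ 2
             + 2 * m ^+ 3 - 2 * m ^+ 2 * n.
  pose c0 := (n + m) ^+ 2 * n * (((n + m) ^+ 2 + m) * (2 - 2 * m - n) - m ^+ 2).
  have nm2 : 0 <= n * m ^+ 2 by rewrite mulr_ge0 ?sqr_ge0.
  have r21 : (n + m) ^+ 2 <= 1 by rewrite expr_le1 ?addr_ge0.
  have c1_ge : n * m ^+ 2 <= c1.
    have h2 : 0 <= m * (n - m) ^+ 2 by rewrite mulr_ge0 ?sqr_ge0.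
    have h3 : 0 <= n ^+ 3 by rewrite exprn_ge0.
    have h4 : 0 <= m ^+ 3 by rewrite exprn_ge0.
    have h5 : 0 <= n ^+ 2 * m by rewrite mulr_ge0 ?sqr_ge0.
    case: (lerP (2 * m ^+ 2) ((n + m) ^+ 2)) => rm.
      have h : 0 <= (n + m) * (1 - (n + m)) * ((n + m) ^+ 2 - 2 * m ^+ 2).
        by rewrite !mulr_ge0 //; lra.
      rewrite /c1; lra.
    have h : 0 <= (n + m) ^+ 2 * (2 * m ^+ 2 - (n + m) ^+ 2).
      by rewrite mulr_ge0 //; lra.
    rewrite /c1; lra.
  have c0_ge : - (n * m ^+ 2) <= c0.
    have h : 0 <= (n + m) ^+ 2 * n * (((n + m) ^+ 2 + m) * (2 - 2 * m - n)).
      by rewrite !mulr_ge0 //; lra.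
    have h2 : 0 <= (1 - (n + m) ^+ 2) * (n * m ^+ 2) by rewrite mulr_ge0 // subr_ge0.
    rewrite /c0; lra.
  rewrite -subr_ge0.
  have -> : 2 * (n + m) ^+ 2 / (2 * v + (n + m) ^+ 2) -
      (n * (2 * m + n) / (v + n) + m ^+ 2 / (v + (n + m) ^+ 2 + m)) =
      (v * c1 + c0) /
        ((2 * v + (n + m) ^+ 2) * (v + n) * (v + (n + m) ^+ 2 + m)).
    by rewrite /c1 /c0; field; rewrite !lt0r_neq0.
  rewrite divr_ge0 //; last by rewrite ltW // !mulr_gt0.
  have : 0 <= (v - 1) * c1 by rewrite mulr_ge0; lra.
  lra.
have e : (n + m) * (1 - (n + m)) * (n / (v + n)) ^+ 2 >= 0.
  by rewrite mulr_ge0 ?sqr_ge0 // mulr_ge0 //; lra.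
have -> : n ^+ 2 / (v + n) = n * (n / (v + n)) by ring.
move: key; have -> : n * (2 * m + n) / (v + n) = n / (v + n) * (2 * m + n) by ring.
lra.
Qed.

(** [ln1D_ge] at [x^2 / v] replaces the rational term of both sign cases by a logarithm, which the
    factor [1 / sqrt v] of the potential will absorb. *)
Lemma exponent_step (n v x : R) : 0 <= n -> 1 <= v -> -1 <= x <= 1 ->
  (n + x) ^+ 2 / (v + x ^+ 2 + `|n + x|) <=
    n ^+ 2 / (v + n) + ln (1 + x ^+ 2 / v)
    + (x * (2 * (n / (v + n)) - (n / (v + n)) ^+ 2) - x ^+ 2 * (n / (v + n)) ^+ 2).
Proof.
move=> n0 v1 x1; have v0 : 0 < v by lra.
have x2 := sqr_ge0 x.
have := @ln1D_ge R (x ^+ 2 / v) (divr_ge0 x2 (ltW v0)).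
have -> : 2 * (x ^+ 2 / v) / (2 + x ^+ 2 / v) = 2 * x ^+ 2 / (2 * v + x ^+ 2).
  by field; rewrite !lt0r_neq0 //; lra.
case: (lerP 0 (n + x)) => nx0 L.
  by have := exponent_step_nneg n0 v1 x1 nx0; rewrite ger0_norm //; lra.
by have := exponent_step_neg n0 v1 x1 (ltW nx0); rewrite ltr0_norm //; lra.
Qed.

(* n is the norm of the current sum s, x the signed length of the component of
   the new gradient along s, and y2 the squared length of the orthogonal one. *)
Lemma exponent_step_plane (n N v x y2 : R) :
  0 <= n -> 0 <= N -> 1 <= v -> -1 <= x <= 1 -> 0 <= y2 ->
  N ^+ 2 = (n + x) ^+ 2 + y2 ->
  N ^+ 2 / (v + (x ^+ 2 + y2) + N) <=
    n ^+ 2 / (v + n) + ln ((v + (x ^+ 2 + y2)) / v)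
    + (x * (2 * (n / (v + n)) - (n / (v + n)) ^+ 2) - x ^+ 2 * (n / (v + n)) ^+ 2).
Proof.
move=> n0 N0 v1 x1 y0 NE; have x2 := sqr_ge0 x.
have NxN : `|n + x| <= N.
  rewrite -(@ler_pXn2r _ 2) ?nnegrE // real_normK ?num_real // NE; lra.
have a0 : 0 <= `|n + x| by [].
have h1 : (n + x) ^+ 2 / (v + (x ^+ 2 + y2) + N) <= (n + x) ^+ 2 / (v + x ^+ 2 + `|n + x|).
  by rewrite ler_wpM2l ?sqr_ge0 // lef_pV2 ?posrE; lra.
have w0 : 0 < v + x ^+ 2 by lra.
(* The orthogonal part is paid for by the second factor of [(v + x^2 + y2) / v = (1 + x^2 / v) * (1
   + y2 / (v + x^2))]. *)
have h2 : y2 / (v + (x ^+ 2 + y2) + N) <= 2 * y2 / (2 * (v + x ^+ 2) + y2).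
  have -> : 2 * y2 / (2 * (v + x ^+ 2) + y2) = y2 / (v + x ^+ 2 + y2 / 2).
    by field; rewrite !lt0r_neq0; lra.
  by rewrite ler_wpM2l // lef_pV2 ?posrE; lra.
have h3 : 2 * y2 / (2 * (v + x ^+ 2) + y2) <= ln (1 + y2 / (v + x ^+ 2)).
  have := @ln1D_ge R (y2 / (v + x ^+ 2)) (divr_ge0 y0 (ltW w0)).
  congr (_ <= _); field; rewrite !lt0r_neq0; lra.
have h4 : ln ((v + (x ^+ 2 + y2)) / v) = ln (1 + x ^+ 2 / v) + ln (1 + y2 / (v + x ^+ 2)).
  rewrite -lnM ?posrE; last 2 first.
  - by rewrite ltr_pwDl // divr_ge0 //; lra.
  - by rewrite ltr_pwDl // divr_ge0 //; lra.
  congr (ln _); field; rewrite !lt0r_neq0; lra.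
have := exponent_step n0 v1 x1.
rewrite h4 NE mulrDl; lra.
Qed.

Definition pot {d : nat} (s : 'rV[R]_d) (v : R) : R :=
  expR (norm2 s ^+ 2 / (2 * v + 2 * norm2 s)) / Num.sqrt v.

(** With [lam = n / (v + n)] and [x] the component of [g] along [s], the right-hand side equals
    [pot s v * (1 + x * (lam - lam^2 / 2))]. After taking logarithms the claim is half of
    [exponent_step_plane], whose last term [ln1D_quadratic_ge] bounds by the logarithm of this
    factor. *)
Lemma pot_step {d : nat} (s g : 'rV[R]_d) (v : R) : 1 <= v -> norm2 g <= 1 ->
  pot (s + g) (v + norm2 g ^+ 2) <= pot s v - dotv g (freegrad_pred 1 1 s v).
Proof.
move=> v1 g1; set n := norm2 s; set w := v + _.
have n0 : 0 <= n by exact: norm2_ge0.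
have v0 : 0 < v by lra.
have w0 : 0 < w by rewrite ltr_wpDr ?sqr_ge0.
(* For [n = 0] division by zero gives [x = 0], and [c = 0] as well: all of [g] then counts as
   orthogonal. *)
pose c := dotv g s; pose x := c / n.
have cle : `|c| <= norm2 g * n by exact: dotv_le.
have nx : n * x = c.
  have [n00|nN0] := eqVneq n 0; last by rewrite mulrC mulfVK.
  by move: cle; rewrite n00 mulr0 mul0r normr_le0 => /eqP.
have xg : `|x| <= norm2 g.
  have [n00|nN0] := eqVneq n 0.
    by rewrite /x n00 invr0 mulr0 normr0 norm2_ge0.
  have np : 0 < n by rewrite lt_def nN0.
  by rewrite normrM normfV (gtr0_norm np) ler_pdivrMr.
have x1 : -1 <= x <= 1 by rewrite -ler_norml (le_trans xg).
have y0 : 0 <= norm2 g ^+ 2 - x ^+ 2.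
  by rewrite subr_ge0 -[x ^+ 2]real_normK ?num_real // ler_pXn2r // nnegrE norm2_ge0.
have NE : norm2 (s + g) ^+ 2 = (n + x) ^+ 2 + (norm2 g ^+ 2 - x ^+ 2).
  rewrite norm2_sqrD dotvC -/c -nx -/n; ring.
have := exponent_step_plane n0 (norm2_ge0 _) v1 x1 y0 NE.
have -> : v + (x ^+ 2 + (norm2 g ^+ 2 - x ^+ 2)) = w by rewrite /w; ring.
set N := norm2 (s + g); set lam := n / (v + n) => H.
have N0 : 0 <= N by exact: norm2_ge0.
have vn0 : 0 < v + n by lra.
have l01 : 0 <= lam <= 1.
  apply/andP; split; first by rewrite divr_ge0 // ltW.
  by rewrite /lam ler_pdivrMr //; lra.
have eta0 : 0 < 1 + x * (lam - lam ^+ 2 / 2).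
  move: l01 x1 => /andP[l0 l1] /andP[xN1 _].
  have e0 : 0 <= lam - lam ^+ 2 / 2 by nra.
  have e1 : lam - lam ^+ 2 / 2 <= 1 / 2 by have := sqr_ge0 (1 - lam); lra.
  have : 0 <= (1 + x) * (lam - lam ^+ 2 / 2) by rewrite mulr_ge0 //; lra.
  lra.
have Q := ln1D_quadratic_ge l01 x1.
have K : N ^+ 2 / (2 * w + 2 * N) <=
    n ^+ 2 / (2 * v + 2 * n) + ln (1 + x * (lam - lam ^+ 2 / 2)) + ln (w / v) / 2.
  have -> : N ^+ 2 / (2 * w + 2 * N) = N ^+ 2 / (w + N) / 2.
    by field; rewrite !lt0r_neq0 //; lra.
  have -> : n ^+ 2 / (2 * v + 2 * n) = n ^+ 2 / (v + n) / 2.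
    by field; rewrite !lt0r_neq0 //; lra.
  lra.
have sqE : expR (ln (w / v) / 2) = Num.sqrt w / Num.sqrt v.
  have wv : 0 < w / v by rewrite divr_gt0.
  rewrite -sqrtrV ?ltW // -sqrtrM ?ltW //.
  apply/eqP; rewrite -(@eqrXn2 _ 2) ?expR_ge0 ?sqrtr_ge0 // sqr_sqrtr ?ltW //.
  by rewrite -expRM_natl mulrC divfK ?pnatr_eq0 // lnK.
have sw : 0 < Num.sqrt w by rewrite sqrtr_gt0.
have sv : 0 < Num.sqrt v by rewrite sqrtr_gt0.
have -> : pot s v - dotv g (freegrad_pred 1 1 s v) =
    expR (n ^+ 2 / (2 * v + 2 * n)) * (1 + x * (lam - lam ^+ 2 / 2)) / Num.sqrt v.
  rewrite /pot /freegrad_pred -/n dotvZr -/c -nx !mulr1 !mul1r expr1n mulr1 /lam.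
  field; rewrite !lt0r_neq0 //; lra.
rewrite /pot -/N ler_pdivrMr //.
have -> : expR (n ^+ 2 / (2 * v + 2 * n)) * (1 + x * (lam - lam ^+ 2 / 2)) / Num.sqrt v
    * Num.sqrt w = expR (n ^+ 2 / (2 * v + 2 * n) + ln (1 + x * (lam - lam ^+ 2 / 2))
      + ln (w / v) / 2).
  by rewrite !expRD lnK // sqE; ring.
by rewrite ler_expR.
Qed.

End Potential.

(** * Regret of a single FreeGrad copy with unit Lipschitz constant *)

Section FreeGrad.
Context {R : realType} {d : nat}.
Implicit Types (g : nat -> 'rV[R]_d) (u s : 'rV[R]_d) (e v : R).

Lemma freegrad_predE e Gh s v :
  freegrad_pred e Gh s v = e *: freegrad_pred 1 Gh s v.
Proof. by rewrite /freegrad_pred scalerA mulNr mulN1r !(mulNr, mulrN) !mulrA. Qed.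

Definition fgsum g t := \sum_(1 <= i < t) g i.
(** The initial value stays [1 ^+ 2], the form of [Gh ^+ 2] in [haar_fixed_pred] at [Gh = 1]. *)
Definition fgvar g t : R := 1 ^+ 2 + \sum_(1 <= i < t) norm2 (g i) ^+ 2.

Lemma fgvar_ge1 g t : 1 <= fgvar g t.
Proof. by rewrite /fgvar expr1n lerDl sumr_ge0 // => i _; rewrite sqr_ge0. Qed.

(** Telescoping of [pot_step] scaled by [e], from the initial potential 1. *)
Lemma freegrad_pot g n e : 0 <= e ->
  (forall t, (1 <= t <= n)%N -> norm2 (g t) <= 1) ->
  \sum_(1 <= t < n.+1) dotv (g t) (freegrad_pred e 1 (fgsum g t) (fgvar g t)) <=
  e - e * pot (fgsum g n.+1) (fgvar g n.+1).
Proof.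
move=> e0; elim: n => [|n IH] g1.
  rewrite big_geq // /fgsum /fgvar !big_geq // /pot norm2_0 expr0n mul0r expR0.
  by rewrite addr0 expr1n sqrtr1 divr1 mulr1 subrr.
rewrite big_nat_recr //=.
have {}IH := IH (fun t h => g1 t (ltac:(lia))).
have := pot_step (fgsum g n.+1) (fgvar_ge1 g n.+1) (g1 n.+1 (ltac:(lia))).
have -> : fgsum g n.+1 + g n.+1 = fgsum g n.+2 by rewrite /fgsum [RHS]big_nat_recr.
have -> : fgvar g n.+1 + norm2 (g n.+1) ^+ 2 = fgvar g n.+2.
  by rewrite /fgvar [in RHS]big_nat_recr //= addrA.
rewrite (freegrad_predE e) dotvZr => /(ler_wpM2l e0); lra.
Qed.

(** The final exponent is compared with [L]. If it is at most [L], then [N <= q * (1 + 3 * L)] and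
    Cauchy-Schwarz bounds the comparator term. Otherwise the final potential times [e] is at least
    [norm2 u * n], which dominates the comparator term since [N <= n]. *)
Lemma freegrad_regret g n e u V : 0 < e ->
  (forall t, (1 <= t <= n)%N -> norm2 (g t) <= 1) -> fgvar g n.+1 <= V ->
  \sum_(1 <= t < n.+1)
    dotv (g t) (freegrad_pred e 1 (fgsum g t) (fgvar g t) - u) <=
  e + norm2 u * Num.sqrt V * (1 + 3 * ln (1 + norm2 u * n%:R * Num.sqrt V / e)).
Proof.
move=> e0 g1 varV; set L := ln _; set q := Num.sqrt V.
have V0_ge1 := fgvar_ge1 g n.+1; set V0 := fgvar g n.+1 in varV V0_ge1.
have V1 : 1 <= V by lra.
have q1 : 1 <= q by rewrite -[1]sqrtr1 ler_wsqrtr.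
have qq : q ^+ 2 = V by rewrite sqr_sqrtr //; lra.
have u0 := norm2_ge0 u.
have n0 : 0 <= n%:R :> R by [].
have arg0 : 0 <= norm2 u * n%:R * q / e by rewrite divr_ge0 ?mulr_ge0 //; lra.
have L0 : 0 <= L by rewrite ln_ge0 // lerDl.
set N := norm2 (fgsum g n.+1).
have N0 : 0 <= N by exact: norm2_ge0.
have Nn : N <= n%:R.
  apply: le_trans (norm2_sum _ _ _) _.
  rewrite big_nat_cond -[n in n%:R](subn1 n.+1) -[(_ - _)%:R]mulr1 mulr_natl -sumr_const_nat.
  rewrite [leRHS]big_nat_cond.
  by apply: ler_sum => t; rewrite andbT => h; apply: g1; lia.
have dotu : - dotv (fgsum g n.+1) u <= norm2 u * N.
  have := dotv_le (fgsum g n.+1) u; rewrite ler_norml mulrC => /andP[+ _]; rewrite -/N; lra.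
have P := freegrad_pot (ltW e0) g1.
have -> : \sum_(1 <= t < n.+1)
    dotv (g t) (freegrad_pred e 1 (fgsum g t) (fgvar g t) - u) =
  \sum_(1 <= t < n.+1) dotv (g t) (freegrad_pred e 1 (fgsum g t) (fgvar g t))
   - dotv (fgsum g n.+1) u.
  under eq_bigr do rewrite dotvBr.
  by rewrite sumrB dotvC dotv_sumr; congr (_ - _); apply: eq_bigr => t _; rewrite dotvC.
set Sg := \sum_(_ <= _ < _) _ in P *.
have pot0 : 0 <= pot (fgsum g n.+1) V0 by rewrite divr_ge0 ?expR_ge0 ?sqrtr_ge0.
have epot0 : 0 <= e * pot (fgsum g n.+1) V0 by rewrite mulr_ge0 // ltW.
case: (lerP (N ^+ 2 / (2 * V0 + 2 * N)) L) => [small|large].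
  suff : norm2 u * N <= norm2 u * q * (1 + 3 * L) by lra.
  rewrite -mulrA ler_wpM2l //.
  move: small; rewrite ler_pdivrMr; last lra.
  (* [small] gives [N * (N - 2 * L) <= 2 * L * V0], whereas [N > q * (1 + 3 * L)] and [q >= 1] force
     [N - 2 * L >= (1 + L) * q]; the product is then too large. *)
  move=> small; rewrite leNgt; apply/negP => big.
  have h1 : L * V0 <= L * q ^+ 2 by rewrite ler_wpM2l // qq.
  have h2 : (1 + L) * q <= N - 2 * L by nra.
  have h3 : 0 <= (1 + L) * q by rewrite mulr_ge0 //; lra.
  have h4 : q * (1 + 3 * L) * ((1 + L) * q) <= N * (N - 2 * L).
    by apply: ler_pM => //; [rewrite mulr_ge0 //; lra | exact: ltW].
  have h5 : 0 < q ^+ 2 by rewrite exprn_gt0 //; lra.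
  have h6 : 0 <= L * q ^+ 2 by rewrite mulr_ge0 // ltW.
  have h7 : 0 <= L * (L * q ^+ 2) by rewrite mulr_ge0.
  nra.
have rhs0 : 0 <= norm2 u * q * (1 + 3 * L) by rewrite !mulr_ge0 //; lra.
suff : norm2 u * N <= e * pot (fgsum g n.+1) V0 by lra.
apply: (@le_trans _ _ (norm2 u * n%:R)); first by rewrite ler_wpM2l.
have sV0 : 0 < Num.sqrt V0 by rewrite sqrtr_gt0; lra.
rewrite /pot mulrA ler_pdivlMr // -/N.
apply: (@le_trans _ _ (e * (1 + norm2 u * n%:R * q / e))).
  rewrite mulrDr mulr1 mulrC [e * (_ / e)]mulrC divfK ?gt_eqF //.
  have : Num.sqrt V0 * (norm2 u * n%:R) <= norm2 u * n%:R * q.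
    by rewrite mulrC ler_wpM2l ?mulr_ge0 // ler_wsqrtr.
  lra.
rewrite ler_pM2l // -[leLHS](@lnK R); last by rewrite posrE; lra.
by rewrite ler_expR ltW.
Qed.

End FreeGrad.

(** * Sums over intervals and blocks, and Cauchy-Schwarz for square roots *)

Section Sums.

(** The minimum with [n - a] strengthens the bound by [c] so that induction on [n] works. *)
Lemma sum_indicator_interval (a c n : nat) :
  (\sum_(0 <= s < n) (a <= s < a + c) <= minn (n - a) c)%N.
Proof.
elim: n => [|n IH]; first by rewrite big_geq.
rewrite big_nat_recr //=; case: (boolP (a <= n < a + c)%N) => h; lia.
Qed.

Lemma sum_blocks (V : nmodType) (f : nat -> V) (D K : nat) :
  \sum_(0 <= i < K) \sum_(D * i <= s < D * i.+1) f s = \sum_(0 <= s < D * K) f s.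
Proof.
elim: K => [|K IH]; first by rewrite muln0 !big_geq.
by rewrite big_nat_recr //= IH -big_cat_nat //= leq_mul2l leqnSn orbT.
Qed.

(** Squared, this is the arithmetic-geometric mean inequality for [a * B] and [A * b]. *)
Lemma sqrt_mul_add (R : realType) (a b A B : R) :
  0 <= a -> 0 <= b -> 0 <= A -> 0 <= B ->
  Num.sqrt (a * b) + Num.sqrt (A * B) <= Num.sqrt ((a + A) * (b + B)).
Proof.
move=> a0 b0 A0 B0.
rewrite -(@ler_pXn2r _ 2) ?nnegrE ?addr_ge0 ?sqrtr_ge0 //.
rewrite sqrrD !sqr_sqrtr ?mulr_ge0 ?addr_ge0 // -sqrtrM ?mulr_ge0 //.
suff : Num.sqrt (a * b * (A * B)) *+ 2 <= a * B + A * b by lra.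
have h : 0 <= a * B + A * b by rewrite addr_ge0 ?mulr_ge0.
rewrite -(@ler_pXn2r _ 2) ?nnegrE ?mulrn_wge0 ?sqrtr_ge0 //.
rewrite -mulr_natl exprMn sqr_sqrtr ?mulr_ge0 //.
by have := sqr_ge0 (a * B - A * b); lra.
Qed.

Lemma sum_sqrt_mul (R : realType) (I : Type) (r : seq I) (F H : I -> R) :
  (forall i, 0 <= F i) -> (forall i, 0 <= H i) ->
  \sum_(i <- r) Num.sqrt (F i * H i) <=
  Num.sqrt ((\sum_(i <- r) F i) * \sum_(i <- r) H i).
Proof.
move=> F0 H0; elim: r => [|i r IH]; first by rewrite !big_nil mul0r sqrtr0.
rewrite !big_cons; apply: le_trans (sqrt_mul_add _ _ _ _) => //.
- by rewrite lerD2l.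
- by apply: sumr_ge0.
- by apply: sumr_ge0.
Qed.

Lemma sumr_nat_widen (R : realType) (f : nat -> R) (a b c e : nat) :
  (forall s, 0 <= f s) -> (c <= a)%N -> (b <= e)%N ->
  \sum_(a <= s < b) f s <= \sum_(c <= s < e) f s.
Proof.
move=> f0 ca be; case: (leqP a b) => ab; last first.
  by rewrite big_geq ?sumr_ge0 // ltnW.
rewrite (@big_cat_nat _ _ _ a c e) //=; last exact: leq_trans be.
rewrite (@big_cat_nat _ _ _ b a e) //=.
have h1 : 0 <= \sum_(c <= s < a) f s by apply: sumr_ge0.
have h2 : 0 <= \sum_(b <= s < e) f s by apply: sumr_ge0.
lra.
Qed.

End Sums.

(** * Haar expansion of the comparator and size of its coefficients *)

Section Haar.
Context {R : realType}.

Lemma haar_cols_sum (V : nmodType) (F : (nat -> R) -> V) (m : nat) :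
  \sum_(h <- haar_cols R m) F h = F (fun _ => 1) +
  \sum_(0 <= k < m) \sum_(0 <= i < 2 ^ (m - k.+1)) F (@haar_h R k.+1 i.+1).
Proof.
rewrite /haar_cols big_cons big_map; congr (_ + _).
rewrite big_allpairs_dep /=.
have -> : iota 1 m = index_iota 1 m.+1 by rewrite /index_iota subn1.
rewrite big_add1 /=; apply: eq_bigr => k _.
have -> : iota 1 (2 ^ (m - k.+1)) = index_iota 1 (2 ^ (m - k.+1)).+1.
  by rewrite /index_iota subn1.
by rewrite big_add1.
Qed.

(** The quotient form shows that at each scale a round meets exactly one column, the one with
    [i = s %/ 2 ^ k.+1]. *)
Lemma haar_hE (k i s : nat) : @haar_h R k.+1 i.+1 s.+1 =
  if (s %/ 2 ^ k == 2 * i)%N then 1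
  else if (s %/ 2 ^ k == (2 * i).+1)%N then -1 else 0.
Proof.
have p0 : (0 < 2 ^ k)%N by rewrite expn_gt0.
rewrite /haar_h !subn1 /=.
have -> : ((2 ^ k.+1 * i < s.+1) && (s.+1 <= 2 ^ k.+1 * i + 2 ^ k) =
   (s %/ 2 ^ k == 2 * i))%N.
  by rewrite eqn_leq -[(_ %/ _ <= _)%N]ltnS ltn_divLR // leq_divRL // expnS andbC; nia.
have -> : ((2 ^ k.+1 * i + 2 ^ k < s.+1) && (s.+1 <= 2 ^ k.+1 * i.+1) =
   (s %/ 2 ^ k == (2 * i).+1))%N.
  by rewrite eqn_leq -[(_ %/ _ <= _)%N]ltnS ltn_divLR // leq_divRL // expnS andbC; nia.
by [].
Qed.

Lemma haar_h_le1 (j l t : nat) : `|@haar_h R j l t| <= 1.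
Proof. by rewrite /haar_h; case: ifP => _; [|case: ifP => _]; rewrite ?normrN ?normr1 ?normr0. Qed.

Lemma haar_h_sqr_le (k i s : nat) :
  (@haar_h R k.+1 i.+1 s.+1) ^+ 2 <=
    ((2 ^ k.+1 * i <= s < 2 ^ k.+1 * i + 2 ^ k.+1)%N : nat)%:R.
Proof.
rewrite /haar_h !subn1 /=.
have := expnS 2 k; set p := (2 ^ k)%N; set q := (2 ^ k.+1)%N => qE.
case: ifP => h1; [|case: ifP => h2]; rewrite ?sqrrN ?expr1n ?expr0n //=.
  by have -> : (q * i <= s < q * i + q)%N by lia.
by have -> : (q * i <= s < q * i + q)%N by lia.
Qed.

Section Coefficients.
Context {d : nat}.
Implicit Types (w : nat -> 'rV[R]_d).

(* Blocks are numbered from 0: block i of length 2^k consists of the rounds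
   2^k i + 1, ..., 2^k (i + 1), and coef w k i belongs to h^(k+1, i+1). *)
Definition blk w (k i : nat) := \sum_(2 ^ k * i <= s < 2 ^ k * i.+1) w s.+1.

Definition coef w (k i : nat) : 'rV[R]_d :=
  (2 ^ k.+1)%:R^-1 *: (blk w k (2 * i) - blk w k (2 * i).+1).

Lemma blk_split w k i : blk w k.+1 i = blk w k (2 * i) + blk w k (2 * i).+1.
Proof.
rewrite /blk.
have -> : (2 ^ k.+1 * i = 2 ^ k * (2 * i))%N by rewrite expnSr mulnA.
have -> : (2 ^ k.+1 * i.+1 = 2 ^ k * (2 * i).+2)%N by rewrite expnSr; lia.
by rewrite -big_cat_nat //= leq_mul2l leqnSn orbT.
Qed.

Definition avg w (k s : nat) := (2 ^ k)%:R^-1 *: blk w k (s %/ 2 ^ k).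

Lemma avg0 w s : avg w 0 s = w s.+1.
Proof. by rewrite /avg /blk expn0 divn1 !mul1n big_nat1 invr1 scale1r. Qed.

Lemma pow2V k : (2 ^ k)%:R^-1 = (2 ^ k.+1)%:R^-1 * 2 :> R.
Proof.
have h : (2 ^ k)%:R != 0 :> R by rewrite pnatr_eq0 expn_eq0.
by rewrite expnS natrM; field.
Qed.

(** Only the block containing [s] contributes; its signed coefficient is the mean over the half
    containing [s] minus the mean over the block. *)
Lemma haar_scale w m k s : (k < m)%N -> (s < 2 ^ m)%N ->
  \sum_(0 <= i < 2 ^ (m - k.+1)) @haar_h R k.+1 i.+1 s.+1 *: coef w k i =
  avg w k s - avg w k.+1 s.
Proof.
move=> km sm; set q := (s %/ 2 ^ k)%N; set i0 := (s %/ 2 ^ k.+1)%N.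
have qi : (q = 2 * i0 + q %% 2)%N.
  by rewrite /i0 expnSr divnMA -/q {1}(divn_eq q 2) mulnC.
have i0m : i0 \in index_iota 0 (2 ^ (m - k.+1)).
  rewrite mem_index_iota /= /i0 ltn_divLR ?expn_gt0 // -expnD subnK //.
rewrite (bigD1_seq i0) ?iota_uniq //= big1 ?addr0; last first.
  move=> i ii0; rewrite haar_hE -/q.
  have -> : (q == 2 * i)%N = false by lia.
  have -> : (q == (2 * i).+1)%N = false by lia.
  by rewrite scale0r.
rewrite haar_hE -/q /avg -/q -/i0 blk_split pow2V /coef.
have [q0|q1] : (q = 2 * i0)%N \/ (q = (2 * i0).+1)%N by lia.
  rewrite q0 eqxx scale1r -scalerA -scalerBr; congr (_ *: _).
  by rewrite scaler_nat mulr2n opprD addrACA subrr add0r.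
have -> : (q == 2 * i0)%N = false by lia.
rewrite q1 eqxx scaleN1r -scalerN -scalerA -scalerBr; congr (_ *: _).
by rewrite scaler_nat mulr2n opprB opprD addrACA subrr addr0 addrC.
Qed.

(** [haar_scale] telescopes from blocks of length 1, whose mean is [w] itself, to the whole
    epoch. *)
Lemma haar_reconstruction w m s : (s < 2 ^ m)%N ->
  w s.+1 = (2 ^ m)%:R^-1 *: blk w m 0 + \sum_(0 <= k < m)
    \sum_(0 <= i < 2 ^ (m - k.+1)) @haar_h R k.+1 i.+1 s.+1 *: coef w k i.
Proof.
move=> sm.
have -> : \sum_(0 <= k < m) \sum_(0 <= i < 2 ^ (m - k.+1))
    @haar_h R k.+1 i.+1 s.+1 *: coef w k i =
  \sum_(0 <= k < m) (- avg w k.+1 s - - avg w k s).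
  rewrite big_nat [RHS]big_nat; apply: eq_bigr => k /andP[_ km].
  by rewrite (haar_scale w km sm) opprK addrC.
rewrite telescope_sumr // opprK avg0 /avg divn_small //.
by rewrite addNKr.
Qed.

(** Both half blocks have length [2 ^ k], so subtracting [c] throughout does not change their
    difference. *)
Lemma coef_le w k i (c : 'rV[R]_d) : norm2 (coef w k i) <=
  (2 ^ k.+1)%:R^-1 * \sum_(2 ^ k.+1 * i <= s < 2 ^ k.+1 * i.+1) norm2 (w s.+1 - c).
Proof.
rewrite /coef norm2Z ger0_norm ?invr_ge0 // ler_wpM2l ?invr_ge0 //.
have shift K : blk w k K = \sum_(2 ^ k * K <= s < 2 ^ k * K.+1) (w s.+1 - c)
    + (2 ^ k)%:R *: c.
  by rewrite /blk sumrB sumr_const_nat -mulnBr subSnn muln1 scaler_nat subrK.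
rewrite !shift opprD addrACA subrr addr0.
apply: le_trans (norm2D _ _) _; rewrite norm2N.
apply: le_trans (lerD (norm2_sum _ _ _) (norm2_sum _ _ _)) _.
have -> : (2 ^ k.+1 * i = 2 ^ k * (2 * i))%N by rewrite expnSr mulnA.
have -> : (2 ^ k.+1 * i.+1 = 2 ^ k * (2 * i).+2)%N by rewrite expnSr; lia.
by rewrite -big_cat_nat //= leq_mul2l leqnSn orbT.
Qed.

Lemma mean_le w m (c : 'rV[R]_d) : norm2 ((2 ^ m)%:R^-1 *: blk w m 0 - c) <=
  (2 ^ m)%:R^-1 * \sum_(0 <= s < 2 ^ m) norm2 (w s.+1 - c).
Proof.
have h : (2 ^ m)%:R != 0 :> R by rewrite pnatr_eq0 expn_eq0.
have -> : (2 ^ m)%:R^-1 *: blk w m 0 - c =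
    (2 ^ m)%:R^-1 *: \sum_(0 <= s < 2 ^ m) (w s.+1 - c).
  rewrite /blk muln0 muln1 sumrB sumr_const_nat subn0 scalerBr -[c *+ _]scaler_nat.
  by rewrite scalerA mulVf // scale1r.
by rewrite norm2Z ger0_norm ?invr_ge0 // ler_wpM2l ?invr_ge0 // norm2_sum.
Qed.

End Coefficients.
End Haar.

(** * Regret of the fixed-horizon algorithm on one epoch *)

Section HaarRegret.
Context {R : realType} {d : nat}.
Implicit Types (g w : nat -> 'rV[R]_d) (h : nat -> R).

Lemma norm2_le_path w (a s b : nat) : (a <= s < b)%N ->
  norm2 (w s.+1 - w a.+1) <= \sum_(a <= r < b) norm2 (w r.+2 - w r.+1).
Proof.
move=> /andP[as_ sb].
have -> : w s.+1 - w a.+1 = \sum_(a <= r < s) (w r.+2 - w r.+1).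
  by rewrite (telescope_sumr (fun r => w r.+1)).
apply: le_trans (norm2_sum _ _ _) _.
by apply: sumr_nat_widen => // [r|]; [exact: norm2_ge0 | exact: ltnW].
Qed.

(** Product of two bounds on the coefficient, one with the first value of the block as centre and
    one with [c]. The path sum includes the step leaving the block, so that these sums add up over
    the blocks of a scale. *)
Lemma coef_sqrt_le w k i (c : 'rV[R]_d) :
  norm2 (coef w k i) * Num.sqrt (2 ^ k.+1)%:R <=
  Num.sqrt ((\sum_(2 ^ k.+1 * i <= s < 2 ^ k.+1 * i.+1) norm2 (w s.+2 - w s.+1)) *
            (\sum_(2 ^ k.+1 * i <= s < 2 ^ k.+1 * i.+1) norm2 (w s.+1 - c))).
Proof.
set P := \sum_(_ <= _ < _) norm2 (w _.+2 - _); set S := \sum_(_ <= _ < _) norm2 (_ - c).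
have P0 : 0 <= P by apply: sumr_ge0 => s _; exact: norm2_ge0.
have S0 : 0 <= S by apply: sumr_ge0 => s _; exact: norm2_ge0.
have D0 : 0 < (2 ^ k.+1)%:R :> R by rewrite ltr0n expn_gt0.
have u0 := norm2_ge0 (coef w k i).
have uS : norm2 (coef w k i) * (2 ^ k.+1)%:R <= S.
  by rewrite -ler_pdivlMr // mulrC coef_le.
have uP : norm2 (coef w k i) <= P.
  apply: le_trans (coef_le w k i (w (2 ^ k.+1 * i).+1)) _.
  rewrite mulrC ler_pdivrMr //.
  apply: (@le_trans _ _ (\sum_(2 ^ k.+1 * i <= s < 2 ^ k.+1 * i.+1) P)).
    rewrite big_nat [leRHS]big_nat; apply: ler_sum => s hs.
    exact: norm2_le_path.
  by rewrite sumr_const_nat -mulnBr subSnn muln1 -[P *+ _]mulr_natr.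
rewrite -(@ler_pXn2r _ 2) ?nnegrE ?mulr_ge0 ?sqrtr_ge0 //.
rewrite sqr_sqrtr ?mulr_ge0 // exprMn (sqr_sqrtr (ltW D0)) expr2 -mulrA.
by rewrite ler_pM // mulr_ge0 // ltW.
Qed.

Lemma fgvar_haar g m k i :
  (forall t, (1 <= t <= 2 ^ m)%N -> norm2 (g t) <= 1) ->
  fgvar (fun t => @haar_h R k.+1 i.+1 t *: g t) (2 ^ m).+1 <= 1 + (2 ^ k.+1)%:R.
Proof.
move=> g1; rewrite /fgvar expr1n lerD2l big_add1 /=.
apply: (@le_trans _ _ (\sum_(0 <= s < 2 ^ m)
   ((2 ^ k.+1 * i <= s < 2 ^ k.+1 * i + 2 ^ k.+1)%N : nat)%:R)).
  rewrite big_nat [leRHS]big_nat; apply: ler_sum => s /andP[_ hs].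
  apply: le_trans (@haar_h_sqr_le R k i s).
  rewrite norm2Z exprMn real_normK ?num_real // -[leRHS]mulr1.
  by rewrite ler_wpM2l ?sqr_ge0 // expr_le1 ?norm2_ge0 // g1.
rewrite -natr_sum ler_nat (leq_trans (sum_indicator_interval _ _ _)) //.
by rewrite geq_minr.
Qed.

Lemma fgvar_const g m : (forall t, (1 <= t <= 2 ^ m)%N -> norm2 (g t) <= 1) ->
  fgvar (fun t => 1 *: g t) (2 ^ m).+1 <= 1 + (2 ^ m)%:R.
Proof.
move=> g1; rewrite /fgvar expr1n lerD2l big_add1 /=.
apply: (@le_trans _ _ (\sum_(0 <= s < 2 ^ m) 1)).
  rewrite big_nat [leRHS]big_nat; apply: ler_sum => s /andP[_ hs].
  by rewrite scale1r expr_le1 ?norm2_ge0 // g1.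
by rewrite sumr_const_nat subn0.
Qed.

(** Common majorant of the logarithmic factor of [freegrad_regret] when [e = 2^-m], [n = 2^m],
    [V <= 1 + 2^m] and [norm2 u <= M]. *)
Definition logfac (m : nat) (M : R) : R :=
  1 + 3 * ln ((1 + M) * (1 + (2 ^ m)%:R) ^+ 3).

Lemma logfac_ge1 m M : 0 <= M -> 1 <= logfac m M.
Proof.
move=> M0; rewrite /logfac lerDl mulr_ge0 // ln_ge0 //.
by rewrite mulr_ege1 ?exprn_ege1 // lerDl.
Qed.

Definition column_regret (m : nat) g h (u : 'rV[R]_d) : R :=
  \sum_(1 <= t < (2 ^ m).+1) dotv (h t *: g t)
    (freegrad_pred (1 / (2 ^ m)%:R) 1 (fgsum (fun t => h t *: g t) t)
       (fgvar (fun t => h t *: g t) t) - u).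

(** In the applications [b] is the length of the support of the column. The factor 2 comes from
    [1 + b <= 4 * b]. *)
Lemma column_regret_le m g h u (M : R) (b : nat) :
  (forall t, (1 <= t <= 2 ^ m)%N -> norm2 (g t) <= 1) ->
  (forall t, `|h t| <= 1) -> norm2 u <= M -> (0 < b <= 2 ^ m)%N ->
  fgvar (fun t => h t *: g t) (2 ^ m).+1 <= 1 + b%:R ->
  column_regret m g h u <=
    (2 ^ m)%:R^-1 + 2 * logfac m M * (norm2 u * Num.sqrt b%:R).
Proof.
move=> g1 h1 uM /andP[b0 bD] hvar; set D : R := (2 ^ m)%:R.
have D1 : 1 <= D by rewrite ler1n expn_gt0.
have u0 := norm2_ge0 u.
have M0 : 0 <= M by lra.
have b1 : 1 <= b%:R :> R by rewrite ler1n.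
have bDr : b%:R <= D by rewrite ler_nat.
have e0 : 0 < 1 / D by rewrite divr_gt0 //; lra.
have hg t : (1 <= t <= 2 ^ m)%N -> norm2 (h t *: g t) <= 1.
  by move=> ht; rewrite norm2Z mulr_ile1 ?norm2_ge0 // g1.
apply: le_trans (freegrad_regret u e0 hg hvar) _.
rewrite {1}div1r lerD2l -/D.
set q := Num.sqrt (1 + _).
have q0 : 0 <= q by exact: sqrtr_ge0.
have qD : q <= 1 + D.
  rewrite -(@ler_pXn2r _ 2) ?nnegrE //; last lra.
  rewrite sqr_sqrtr; last lra.
  nra.
have q2 : q <= 2 * Num.sqrt b%:R.
  rewrite -(@ler_pXn2r _ 2) ?nnegrE ?mulr_ge0 ?sqrtr_ge0 //.
  by rewrite exprMn !sqr_sqrtr; lra.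
have ln_le : ln (1 + norm2 u * D * q / (1 / D)) <= ln ((1 + M) * (1 + D) ^+ 3).
  have -> : norm2 u * D * q / (1 / D) = norm2 u * (D * D * q).
    by field; apply: lt0r_neq0; lra.
  have a0 : 0 <= D * D * q by rewrite !mulr_ge0 //; lra.
  have a1 : D * D * q <= (1 + D) ^+ 3.
    have : D * D * q <= D * D * (1 + D) by rewrite ler_wpM2l // mulr_ge0; lra.
    have : 0 <= D ^+ 2 by exact: sqr_ge0.
    lra.
  have a2 : norm2 u * (D * D * q) <= M * (1 + D) ^+ 3 by rewrite ler_pM.
  have a3 : 1 <= (1 + D) ^+ 3 by rewrite exprn_ege1 // lerDl; lra.
  have a4 : 0 <= norm2 u * (D * D * q) by rewrite mulr_ge0.
  rewrite ler_ln ?posrE; lra.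
have L0 : 0 <= ln (1 + norm2 u * D * q / (1 / D)).
  by rewrite ln_ge0 // lerDl divr_ge0 ?mulr_ge0 //; lra.
have -> : 2 * logfac m M * (norm2 u * Num.sqrt b%:R) =
   norm2 u * (2 * Num.sqrt b%:R) * logfac m M by ring.
rewrite ler_pM ?mulr_ge0 //; first lra.
  by rewrite ler_wpM2l.
by rewrite /logfac; lra.
Qed.

(** Prediction and comparator are expanded over the same columns; by bilinearity the entry [h t]
    moves onto the gradient, which gives the linear regret of each copy. *)
Lemma haar_regret_columns m g w :
  \sum_(1 <= t < (2 ^ m).+1) dotv (g t) (haar_fixed_pred m 1 1 g t - w t) =
  column_regret m g (fun _ => 1) ((2 ^ m)%:R^-1 *: blk w m 0) +
  \sum_(0 <= k < m) \sum_(0 <= i < 2 ^ (m - k.+1))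
     column_regret m g (@haar_h R k.+1 i.+1) (coef w k i).
Proof.
pose F h t u := dotv (h t *: g t)
    (freegrad_pred (1 / (2 ^ m)%:R) 1 (fgsum (fun t => h t *: g t) t)
       (fgvar (fun t => h t *: g t) t) - u) : R.
have split t : (1 <= t < (2 ^ m).+1)%N ->
    dotv (g t) (haar_fixed_pred m 1 1 g t - w t) =
    F (fun _ => 1) t ((2 ^ m)%:R^-1 *: blk w m 0) +
    \sum_(0 <= k < m) \sum_(0 <= i < 2 ^ (m - k.+1))
       F (@haar_h R k.+1 i.+1) t (coef w k i).
  case: t => // s; rewrite ltnS => /andP[_ sm].
  rewrite (haar_reconstruction w sm) /haar_fixed_pred haar_cols_sum opprD addrACA.
  rewrite -sumrB dotvDr scale1r /F !scale1r; congr (_ + _).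
  rewrite dotv_sumr; apply: eq_bigr => k _.
  rewrite -sumrB dotv_sumr; apply: eq_bigr => i _.
  by rewrite -scalerBr dotvZr dotvZl.
rewrite big_nat (eq_bigr _ split) -big_nat big_split /=; congr (_ + _).
rewrite exchange_big; apply: eq_bigr => k _.
by rewrite exchange_big.
Qed.

(** The factor [1 + m] counts the constant column and the [m] scales, all with the same bound. The
    pointwise distance to [c] serves the constant column, the path length serves the scales. *)
Lemma haar_fixed_regret m g w (c : 'rV[R]_d) (P S M : R) : 0 <= M ->
  (forall t, (1 <= t <= 2 ^ m)%N -> norm2 (g t) <= 1) ->
  (forall t, norm2 (w t) <= M) -> (forall t, norm2 (w t - c) <= P) ->
  \sum_(0 <= s < 2 ^ m) norm2 (w s.+2 - w s.+1) <= P ->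
  \sum_(0 <= s < 2 ^ m) norm2 (w s.+1 - c) <= S ->
  \sum_(1 <= t < (2 ^ m).+1) dotv (g t) (haar_fixed_pred m 1 1 g t - w t) <=
  (1 + m%:R) * (1 + 2 * logfac m M *
    (norm2 c * Num.sqrt (2 ^ m)%:R + Num.sqrt (P * S))).
Proof.
move=> M0 g1 wM wP pathP devS; set D : R := (2 ^ m)%:R.
have D1 : 1 <= D by rewrite ler1n expn_gt0.
have D0 : 0 < D by lra.
have P0 : 0 <= P by apply: le_trans (wP 0%N); exact: norm2_ge0.
have S0 : 0 <= S by apply: le_trans devS; apply: sumr_ge0 => s _; exact: norm2_ge0.
have K1 := @logfac_ge1 m M M0.
have c0 : 0 <= norm2 c * Num.sqrt D by rewrite mulr_ge0 ?norm2_ge0 ?sqrtr_ge0.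
have PS0 : 0 <= Num.sqrt (P * S) by exact: sqrtr_ge0.
have avgM (b : nat) (f : nat -> R) (B : R) (a : nat) : (0 < b)%N ->
    (forall s, f s <= B) -> b%:R^-1 * \sum_(a <= s < a + b) f s <= B.
  move=> b0 fB; rewrite mulrC ler_pdivrMr ?ltr0n //.
  apply: (@le_trans _ _ (\sum_(a <= s < a + b) B)); first by apply: ler_sum.
  by rewrite sumr_const_nat addKn -[B *+ _]mulr_natr.
rewrite haar_regret_columns mulrDl mul1r; apply: lerD.
  set mu := _ *: blk w m 0.
  have muM : norm2 mu <= M.
    have := mean_le w m 0; rewrite subr0 => /le_trans; apply.
    apply: (avgM (2 ^ m)%N (fun s => norm2 (w s.+1 - 0)) M 0%N).
      by rewrite expn_gt0.
    by move=> s; rewrite subr0.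
  have muS : norm2 (mu - c) * D <= S.
    rewrite -ler_pdivlMr // mulrC; apply: le_trans (mean_le w m c) _.
    by rewrite ler_wpM2l // invr_ge0 ltW.
  have muP : norm2 (mu - c) <= P.
    apply: le_trans (mean_le w m c) _.
    by apply: (avgM (2 ^ m)%N (fun s => norm2 (w s.+1 - c)) P 0%N); rewrite ?expn_gt0.
  (* As for the coefficients: the deviation of the epoch mean is at most both [P] and [S / D]. *)
  have dev : norm2 (mu - c) * Num.sqrt D <= Num.sqrt (P * S).
    rewrite -(@ler_pXn2r _ 2) ?nnegrE ?mulr_ge0 ?sqrtr_ge0 ?norm2_ge0 //.
    rewrite sqr_sqrtr ?mulr_ge0 // exprMn (sqr_sqrtr (ltW D0)) expr2 -mulrA.
    by rewrite ler_pM ?mulr_ge0 ?norm2_ge0 // ltW.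
  have mu_c : norm2 mu <= norm2 c + norm2 (mu - c).
    by have := norm2D c (mu - c); rewrite addrC subrK.
  have h1 t : `|(fun _ : nat => 1 : R) t| <= 1 by rewrite normr1.
  have bD : (0 < 2 ^ m <= 2 ^ m)%N by rewrite expn_gt0 /=.
  apply: le_trans (column_regret_le g1 h1 muM bD (fgvar_const g1)) _.
  apply: lerD; first by rewrite invf_le1.
  clear h1; rewrite ler_wpM2l ?mulr_ge0 //; first lra.
  have : norm2 mu * Num.sqrt D <= (norm2 c + norm2 (mu - c)) * Num.sqrt D.
    by rewrite ler_wpM2r ?sqrtr_ge0.
  lra.
apply: (@le_trans _ _ (\sum_(0 <= k < m) (1 + 2 * logfac m M *
    (norm2 c * Num.sqrt D + Num.sqrt (P * S))))); last first.
  by rewrite sumr_const_nat subn0 -[leLHS]mulr_natl.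
rewrite big_nat [leRHS]big_nat; apply: ler_sum => k /andP[_ km].
have powE : (2 ^ k.+1 * 2 ^ (m - k.+1) = 2 ^ m)%N by rewrite -expnD subnKC.
have coefM i : norm2 (coef w k i) <= M.
  apply: le_trans (coef_le w k i 0) _; rewrite mulnS addnC.
  apply: (avgM (2 ^ k.+1)%N (fun s => norm2 (w s.+1 - 0))); first by rewrite expn_gt0.
  by move=> s; rewrite subr0.
have bD : (0 < 2 ^ k.+1 <= 2 ^ m)%N by rewrite expn_gt0 leq_pexp2l.
pose Q i := \sum_(2 ^ k.+1 * i <= s < 2 ^ k.+1 * i.+1) norm2 (w s.+2 - w s.+1).
pose V i := \sum_(2 ^ k.+1 * i <= s < 2 ^ k.+1 * i.+1) norm2 (w s.+1 - c).
have Q0 i : 0 <= Q i by apply: sumr_ge0 => s _; exact: norm2_ge0.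
have V0 i : 0 <= V i by apply: sumr_ge0 => s _; exact: norm2_ge0.
apply: (@le_trans _ _ (\sum_(0 <= i < 2 ^ (m - k.+1))
    (D^-1 + 2 * logfac m M * Num.sqrt (Q i * V i)))).
  apply: ler_sum => i _.
  apply: le_trans (column_regret_le g1 (@haar_h_le1 R k.+1 i.+1) (coefM i) bD
    (@fgvar_haar g m k i g1)) _.
  rewrite lerD2l ler_wpM2l ?coef_sqrt_le //; lra.
rewrite big_split /= -mulr_sumr sumr_const_nat subn0; apply: lerD.
  (* A scale has at most [2 ^ m] columns, each with additive cost [D^-1]. *)
  by rewrite -[leLHS]mulr_natr mulrC ler_pdivrMr // mul1r ler_nat leq_pexp2l // leq_subr.
rewrite ler_wpM2l //; first lra.
apply: (@le_trans _ _ (Num.sqrt (P * S))); last lra.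
apply: le_trans (sum_sqrt_mul _ Q0 V0) _.
rewrite ler_wsqrtr // /Q /V !sum_blocks powE ler_pM //.
  by apply: sumr_ge0 => s _; exact: norm2_ge0.
by apply: sumr_ge0 => s _; exact: norm2_ge0.
Qed.

End HaarRegret.

(** * Reduction to Lipschitz constant 1 *)

Section Scaling.
Context {R : realType} {d : nat}.
Variables (G : R) (hG : 0 < G).
Implicit Types (g : nat -> 'rV[R]_d).

Lemma freegrad_pred_scale e (s : 'rV[R]_d) v : 0 < v ->
  freegrad_pred e G s v = freegrad_pred e 1 (G^-1 *: s) (v / G ^+ 2).
Proof.
move=> v0; have n0 := norm2_ge0 s.
rewrite /freegrad_pred scalerA norm2Z gtr0_norm ?invr_gt0 //.
set n := norm2 s in n0 *.
have vn : 0 < v + G * n by rewrite ltr_wpDr // mulr_ge0 // ltW.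
have sv : 0 < Num.sqrt v by rewrite sqrtr_gt0.
have -> : Num.sqrt (v / G ^+ 2) = Num.sqrt v / G.
  by rewrite sqrtrM ?ltW // -exprVn sqrtr_sqr gtr0_norm // invr_gt0.
have -> : (G^-1 * n) ^+ 2 / (2 * (v / G ^+ 2) + 2 * 1 * (G^-1 * n)) =
    n ^+ 2 / (2 * v + 2 * G * n).
  by field; rewrite !lt0r_neq0 //; lra.
by congr (_ *: _); field; rewrite !lt0r_neq0 //; lra.
Qed.

Lemma haar_fixed_pred_scale m g g' tau :
  (forall i, (1 <= i < tau)%N -> g' i = G^-1 *: g i) ->
  haar_fixed_pred m 1 G g tau = haar_fixed_pred m 1 1 g' tau.
Proof.
move=> gE; apply: eq_bigr => h _; congr (_ *: _).
have G2 : 0 < G ^+ 2 by rewrite exprn_gt0.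
rewrite freegrad_pred_scale; last first.
  by rewrite ltr_wpDr // sumr_ge0 // => i _; exact: sqr_ge0.
congr freegrad_pred.
  rewrite scaler_sumr big_nat [RHS]big_nat; apply: eq_bigr => i hi.
  by rewrite gE // !scalerA mulrC.
rewrite mulrDl divff ?gt_eqF // expr1n; congr (_ + _).
rewrite mulr_suml big_nat [RHS]big_nat; apply: eq_bigr => i hi.
rewrite gE // !norm2Z [`|G^-1|]gtr0_norm ?invr_gt0 //.
by field; rewrite gt_eqF.
Qed.

(** Agreement is asked only before [t], which allows [g'] to be cut off after the horizon. *)
Lemma anytime_pred_scale g g' t : (0 < t)%N ->
  (forall i, (1 <= i < t)%N -> g' i = G^-1 *: g i) ->
  anytime_pred G g t = anytime_pred 1 g' t.
Proof.
move=> t0 gE; rewrite /anytime_pred.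
apply: haar_fixed_pred_scale => i hi; apply: gE.
have := @trunc_log_ltn 2 t.+1 isT; have := @trunc_logP 2 t.+1 isT isT.
rewrite -/(epoch t) expnS; lia.
Qed.

End Scaling.

(** * Passage between global rounds and rounds of an epoch *)

Section Epochs.

Lemma sum_epochs (V : nmodType) (f : nat -> V) (E : nat) :
  \sum_(1 <= t < 2 ^ E.+1 - 1) f t =
  \sum_(0 <= i < E) \sum_(1 <= tau < (2 ^ i.+1).+1) f (tau + 2 ^ i.+1 - 2)%N.
Proof.
elim: E => [|E IH]; first by rewrite !big_geq.
rewrite [RHS]big_nat_recr //= -IH.
have h1 := expnS 2 E; have h2 := expnS 2 E.+1; have h3 := expn_gt0 2 E.
rewrite (@big_cat_nat _ _ _ (2 ^ E.+1 - 1)%N) //=; try lia.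
congr (_ + _).
have -> : (2 ^ E.+1 - 1 = 1 + (2 ^ E.+1 - 2))%N by lia.
have -> : (2 ^ E.+2 - 1 = (2 ^ E.+1).+1 + (2 ^ E.+1 - 2))%N by lia.
rewrite big_addn addnK; apply: eq_bigr => i _; congr f; lia.
Qed.

Lemma epoch_local m tau : (0 < m)%N -> (1 <= tau <= 2 ^ m)%N ->
  epoch (tau + 2 ^ m - 2) = m.
Proof.
move=> m0 ht; have h := expnS 2 m.
have h1 : (2 <= 2 ^ m)%N by rewrite -{1}(expn1 2) leq_pexp2l.
by apply: trunc_log_eq => //; lia.
Qed.

Lemma anytime_pred_local {R : realType} {d : nat} (Gh : R) (g : nat -> 'rV[R]_d) m tau :
  (0 < m)%N -> (1 <= tau <= 2 ^ m)%N ->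
  anytime_pred Gh g (tau + 2 ^ m - 2) =
  haar_fixed_pred m 1 Gh (fun i => g (i + 2 ^ m - 2)%N) tau.
Proof.
move=> m0 ht; rewrite /anytime_pred (epoch_local m0 ht).
have h1 : (2 <= 2 ^ m)%N by rewrite -{1}(expn1 2) leq_pexp2l.
by congr (haar_fixed_pred _ _ _ _ _); lia.
Qed.

End Epochs.

(** * Padding of the comparator beyond the horizon *)

Section Comparator.
Context {R : realType} {d : nat}.
Variables (T : nat) (u : nat -> 'rV[R]_d).
Hypothesis T0 : (0 < T)%N.

(* Padding with the mean leaves Sbar unchanged and at most doubles path_len. *)
Definition padded (t : nat) := if (1 <= t <= T)%N then u t else ubar T u.

Lemma path_len_ge0 : 0 <= path_len T u.
Proof. by apply: sumr_ge0 => t _; exact: norm2_ge0. Qed.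

Lemma norm2_le_path_len s t : (1 <= s <= T)%N -> (1 <= t <= T)%N ->
  norm2 (u t - u s) <= path_len T u.
Proof.
wlog st : s t / (s <= t)%N.
  move=> H hs ht; case: (leqP s t) => st; first exact: H.
  by rewrite norm2_distC; apply: H => //; exact: ltnW.
move=> hs ht; rewrite -telescope_sumr //.
apply: le_trans (norm2_sum _ _ _) _.
by apply: sumr_nat_widen => [r||]; rewrite ?norm2_ge0 //; lia.
Qed.

(** Balls are convex. The centres used are [u t], for the path length, and 0, for [umax]. *)
Lemma ubar_dist_le (c : 'rV[R]_d) (B : R) :
  (forall t, (1 <= t <= T)%N -> norm2 (u t - c) <= B) -> norm2 (ubar T u - c) <= B.
Proof.
move=> h; have Tr : 0 < T%:R :> R by rewrite ltr0n.
have -> : ubar T u - c = T%:R^-1 *: \sum_(1 <= t < T.+1) (u t - c).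
  rewrite /ubar sumrB sumr_const_nat subn1 /= scalerBr -[c *+ _]scaler_nat.
  by rewrite scalerA mulVf ?gt_eqF // scale1r.
rewrite norm2Z gtr0_norm ?invr_gt0 // mulrC ler_pdivrMr //.
apply: le_trans (norm2_sum _ _ _) _.
apply: (@le_trans _ _ (\sum_(1 <= t < T.+1) B)).
  by rewrite big_nat [leRHS]big_nat; apply: ler_sum => t ht; apply: h; lia.
by rewrite sumr_const_nat subn1 -[B *+ _]mulr_natr.
Qed.

Lemma norm2_ubar_le t : (1 <= t <= T)%N -> norm2 (u t - ubar T u) <= path_len T u.
Proof.
by move=> ht; rewrite norm2_distC; apply: ubar_dist_le => s hs; exact: norm2_le_path_len.
Qed.

Lemma padded_dist t : norm2 (padded t - ubar T u) <= path_len T u.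
Proof.
rewrite /padded; case: ifP => ht; first exact: norm2_ubar_le.
by rewrite subrr norm2_0 path_len_ge0.
Qed.

Lemma padded_umax t : norm2 (padded t) <= umax T u.
Proof.
have h s : (1 <= s <= T)%N -> norm2 (u s) <= umax T u.
  move=> hs; rewrite /umax; apply: (@le_bigmax_seq _ _ _ _ _ s) => //.
  by rewrite mem_index_iota; lia.
rewrite /padded; case: ifP => ht; first exact: h.
rewrite -[ubar T u]subr0; apply: ubar_dist_le => s hs; rewrite subr0; exact: h.
Qed.

Lemma padded_path K :
  \sum_(1 <= t < K) norm2 (padded t.+1 - padded t) <= 2 * path_len T u.
Proof.
(* Raising the upper limit past [T] avoids distinguishing [K <= T] from [K > T]; the only new jump
   is at [t = T]. *)
apply: (@le_trans _ _ (\sum_(1 <= t < K + T.+1) norm2 (padded t.+1 - padded t))).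
  by apply: sumr_nat_widen => [t|//|]; rewrite ?norm2_ge0 ?leq_addr.
rewrite (@big_cat_nat _ _ _ T) //=; last lia.
rewrite [X in _ + X]big_ltn; last lia.
rewrite [X in _ + (_ + X)]big_nat [X in _ + (_ + X)]big1 => [|t ht]; last first.
  rewrite /padded; have -> : (0 < t <= T)%N = false by lia.
  have -> : (0 < t.+1 <= T)%N = false by lia.
  by rewrite subrr norm2_0.
have -> : \sum_(1 <= t < T) norm2 (padded t.+1 - padded t) = path_len T u.
  rewrite /path_len big_nat [RHS]big_nat; apply: eq_bigr => t ht.
  rewrite /padded; have -> : (0 < t <= T)%N by lia.
  by have -> : (0 < t.+1 <= T)%N by lia.
have : norm2 (padded T.+1 - padded T) <= path_len T u.
  rewrite /padded ltnn T0 leqnn norm2_distC; apply: norm2_ubar_le.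
  by rewrite T0 leqnn.
rewrite addr0; lra.
Qed.

Lemma padded_dev K :
  \sum_(1 <= t < K) norm2 (padded t - ubar T u) <= Sbar T u.
Proof.
apply: (@le_trans _ _ (\sum_(1 <= t < K + T.+1) norm2 (padded t - ubar T u))).
  by apply: sumr_nat_widen => [t|//|]; rewrite ?norm2_ge0 ?leq_addr.
rewrite (@big_cat_nat _ _ _ T.+1) //=; last lia.
rewrite [X in _ + X]big_nat [X in _ + X]big1 => [|t ht]; last first.
  rewrite /padded; have -> : (0 < t <= T)%N = false by lia.
  by rewrite subrr norm2_0.
rewrite addr0 /Sbar big_nat [leRHS]big_nat; apply: ler_sum => t ht.
by rewrite /padded; have -> : (0 < t <= T)%N by lia.
Qed.

End Comparator.

(** * Summation over epochs and logarithmic factors *)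

Section Regret.
Context {R : realType} {d : nat}.
Variables (T : nat) (u : nat -> 'rV[R]_d).
Hypothesis T0 : (0 < T)%N.

Lemma epoch_regret m (g : nat -> 'rV[R]_d) : (0 < m)%N ->
  (forall t, norm2 (g t) <= 1) ->
  \sum_(1 <= tau < (2 ^ m).+1)
     dotv (g (tau + 2 ^ m - 2)%N)
       (anytime_pred 1 g (tau + 2 ^ m - 2) - padded T u (tau + 2 ^ m - 2)) <=
  (1 + m%:R) * (1 + 2 * logfac m (umax T u) *
    (norm2 (ubar T u) * Num.sqrt (2 ^ m)%:R
     + Num.sqrt (2 * path_len T u * Sbar T u))).
Proof.
move=> m0 g1.
have h1 : (2 <= 2 ^ m)%N by rewrite -{1}(expn1 2) leq_pexp2l.
pose w tau := padded T u (tau + 2 ^ m - 2)%N.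
have M0 : 0 <= umax T u by apply: le_trans (padded_umax u T0 1); exact: norm2_ge0.
have P0 := path_len_ge0 T u.
(* The bound [2 * path_len T u] allows for the jump into the padding. *)
have := @haar_fixed_regret R d m (fun i => g (i + 2 ^ m - 2)%N) w (ubar T u)
   (2 * path_len T u) (Sbar T u) (umax T u) M0 (fun t _ => g1 _).
have -> : \sum_(1 <= t < (2 ^ m).+1) dotv (g (t + 2 ^ m - 2)%N)
     (haar_fixed_pred m 1 1 (fun i => g (i + 2 ^ m - 2)%N) t - w t) =
  \sum_(1 <= tau < (2 ^ m).+1)
     dotv (g (tau + 2 ^ m - 2)%N)
       (anytime_pred 1 g (tau + 2 ^ m - 2) - padded T u (tau + 2 ^ m - 2)).
  rewrite big_nat [RHS]big_nat; apply: eq_bigr => tau ht.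
  by rewrite anytime_pred_local.
apply.
- by move=> t; exact: padded_umax.
- move=> t; apply: le_trans (padded_dist u T0 _) _; lra.
- apply: (le_trans _ (padded_path u T0 (2 ^ m + (2 ^ m - 1))%N)).
  (* Local round [s.+1] is global round [s + (2 ^ m - 1)]; the sum is then extended down to round
     1. *)
  apply: (@le_trans _ _ (\sum_(0 + (2 ^ m - 1) <= t < 2 ^ m + (2 ^ m - 1))
     norm2 (padded T u t.+1 - padded T u t))); last first.
    by apply: sumr_nat_widen => [t|//|//]; rewrite ?norm2_ge0 //; lia.
  rewrite big_addn addnK le_eqVlt; apply/orP; left; apply/eqP.
  apply: eq_bigr => s _; congr (norm2 (padded T u _ - padded T u _)); lia.
- apply: (le_trans _ (padded_dev u T0 (2 ^ m + (2 ^ m - 1))%N)).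
  apply: (@le_trans _ _ (\sum_(0 + (2 ^ m - 1) <= t < 2 ^ m + (2 ^ m - 1))
     norm2 (padded T u t - ubar T u))); last first.
    by apply: sumr_nat_widen => [t|//|//]; rewrite ?norm2_ge0 //; lia.
  rewrite big_addn addnK le_eqVlt; apply/orP; left; apply/eqP.
  apply: eq_bigr => s _; congr (norm2 (padded T u _ - _)); lia.
Qed.

(** This is the base of the power [polylog]. *)
Definition logT : R := 1 + ln (1 + T%:R) + ln (1 + umax T u).

Lemma epoch_le_log (E : nat) : (2 ^ E <= T.+1)%N -> E%:R <= 2 * ln (1 + T%:R) :> R.
Proof.
move=> h.
have h2 : 2 / 3 <= ln (2 : R).
  have := @ln1D_ge R 1 ler01; have -> : 1 + 1 = 2 :> R by ring.
  by have -> : 2 * 1 / (2 + 1) = 2 / 3 :> R by field.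
have : ln ((2 : R) ^+ E) <= ln (1 + T%:R).
  rewrite ler_ln ?posrE ?exprn_gt0 ?ltr_pwDl //.
  by rewrite -natrX nat1r ler_nat.
rewrite lnXn // -[_ *+ E]mulr_natl.
have : E%:R * (2 / 3) <= E%:R * ln (2 : R) by rewrite ler_wpM2l.
have : 0 <= E%:R :> R by [].
lra.
Qed.

(** From [1 + 2^m <= (1 + T)^2] the coefficient of [ln (1 + T)] is [3 * 3 * 2 = 18]. *)
Lemma logfac_le m : (2 ^ m <= T.+1)%N -> logfac m (umax T u) <= 18 * logT.
Proof.
move=> h; have M0 : 0 <= umax T u by apply: le_trans (padded_umax u T0 1); exact: norm2_ge0.
have T1 : 1 <= T%:R :> R by rewrite ler1n.
have D0 : 0 < (2 ^ m)%:R :> R by rewrite ltr0n expn_gt0.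
have hD : (2 ^ m)%:R <= 1 + T%:R :> R by rewrite nat1r ler_nat.
have lM : 0 <= ln (1 + umax T u) by rewrite ln_ge0 // lerDl.
rewrite /logfac lnM ?posrE ?exprn_gt0 //; [|lra..].
rewrite lnXn; last lra.
have : ln (1 + (2 ^ m)%:R) <= ln ((1 + T%:R) ^+ 2) :> R.
  by rewrite ler_ln ?posrE ?exprn_gt0 //; nra.
rewrite lnXn; last lra.
rewrite /logT; lra.
Qed.

Lemma anytime_linear_regret (g : nat -> 'rV[R]_d) :
  (forall t, norm2 (g t) <= 1) -> (forall t, (T < t)%N -> g t = 0) ->
  \sum_(1 <= t < T.+1) dotv (g t) (anytime_pred 1 g t - padded T u t) <=
  288 * logT ^+ 3 *
   (1 + norm2 (ubar T u) * Num.sqrt T%:R + Num.sqrt (path_len T u * Sbar T u)).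
Proof.
move=> g1 gT.
have hE2 := @trunc_log_ltn 2 T.+1 isT; have hE1 := @trunc_logP 2 T.+1 isT isT.
set E := trunc_log 2 T.+1 in hE1 hE2.
have T1 : 1 <= T%:R :> R by rewrite ler1n.
pose f t := dotv (g t) (anytime_pred 1 g t - padded T u t).
(* The gradients vanish after [T], so the sum may run to [2 ^ E.+1 - 2], the last round of epoch
   [E]. *)
have -> : \sum_(1 <= t < T.+1) f t = \sum_(1 <= t < 2 ^ E.+1 - 1) f t.
  rewrite [RHS](@big_cat_nat _ _ _ T.+1) //=; last lia.
  rewrite [X in _ + X]big_nat [X in _ + X]big1 ?addr0 // => t ht.
  by rewrite /f gT ?dot0v //; lia.
set a := norm2 (ubar T u) * Num.sqrt T%:R; set b := Num.sqrt (path_len T u * Sbar T u).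
have P0 := path_len_ge0 T u.
have S0 : 0 <= Sbar T u by apply: sumr_ge0 => t _; exact: norm2_ge0.
have a0 : 0 <= a by rewrite mulr_ge0 ?norm2_ge0 ?sqrtr_ge0.
have b0 : 0 <= b by exact: sqrtr_ge0.
have M0 : 0 <= umax T u by apply: le_trans (padded_umax u T0 1); exact: norm2_ge0.
have lM : 0 <= ln (1 + umax T u) by rewrite ln_ge0 // lerDl.
have lT : 0 <= ln (1 + T%:R) :> R by rewrite ln_ge0 // lerDl.
have ell1 : 1 <= logT by rewrite /logT; lra.
have E_log := epoch_le_log hE1.
have sqrt2_le (y : R) : 0 <= y -> Num.sqrt (2 * y) <= 2 * Num.sqrt y.
  move=> y0; rewrite -(@ler_pXn2r _ 2) ?nnegrE ?mulr_ge0 ?sqrtr_ge0 //.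
  by rewrite exprMn !sqr_sqrtr ?mulr_ge0 //; lra.
rewrite sum_epochs.
(* Here [1 + m <= 2 * logT], and [72 = 2 * 18 * 2] combines [logfac_le] with the doubling of [a] and
   [b]. At most [2 * logT] epochs give [288 = 2 * 2 * 72]. *)
apply: (@le_trans _ _ (\sum_(0 <= i < E) (2 * logT * (72 * logT * (1 + a + b))))).
  rewrite big_nat [leRHS]big_nat; apply: ler_sum => i /andP[_ iE].
  have mT : (2 ^ i.+1 <= T.+1)%N by apply: leq_trans hE1; rewrite leq_pexp2l.
  apply: le_trans (epoch_regret (ltn0Sn i) g1) _.
  have m_log := epoch_le_log mT.
  have K_le := logfac_le mT; have K1 := @logfac_ge1 R i.+1 _ M0.
  have a_le : norm2 (ubar T u) * Num.sqrt (2 ^ i.+1)%:R <= 2 * a.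
    rewrite /a [2 * _]mulrCA ler_wpM2l ?norm2_ge0 //.
    apply: le_trans (sqrt2_le _ _); last lra.
    by rewrite ler_wsqrtr // -natrM ler_nat; lia.
  have b_le : Num.sqrt (2 * path_len T u * Sbar T u) <= 2 * b.
    by rewrite -mulrA sqrt2_le // mulr_ge0.
  have a'0 : 0 <= norm2 (ubar T u) * Num.sqrt (2 ^ i.+1)%:R.
    by rewrite mulr_ge0 ?norm2_ge0 ?sqrtr_ge0.
  have b'0 : 0 <= Num.sqrt (2 * path_len T u * Sbar T u) by exact: sqrtr_ge0.
  set a' := _ * Num.sqrt (2 ^ i.+1)%:R in a_le a'0 *.
  set b' := Num.sqrt (2 * _ * _) in b_le b'0 *.
  set K := logfac _ _ in K_le K1 *.
  have KX : K * (a' + b') <= 18 * logT * (2 * a + 2 * b) by rewrite ler_pM //; lra.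
  have K'0 : 0 <= K * (a' + b') by rewrite mulr_ge0 //; lra.
  apply: ler_pM.
  - by have : 0 <= i.+1%:R :> R by []; lra.
  - by rewrite -mulrA; lra.
  - by rewrite /logT; lra.
  - rewrite -mulrA; lra.
rewrite sumr_const_nat subn0 -[leLHS]mulr_natl.
have X0 : 0 <= 2 * logT * (72 * logT * (1 + a + b)) by rewrite !mulr_ge0 //; lra.
have : E%:R * (2 * logT * (72 * logT * (1 + a + b))) <=
    2 * logT * (2 * logT * (72 * logT * (1 + a + b))).
  by rewrite ler_wpM2r // (le_trans E_log) // /logT; lra.
by move/le_trans; apply; rewrite le_eqVlt; apply/orP; left; apply/eqP; ring.
Qed.

End Regret.

(** * From convex losses to normalised linear losses *)

Lemma subgradient_norm_le (R : realType) (d : nat) (G : R) (f : 'rV[R]_d -> R) x g :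
  0 < G -> lipschitz_fun G f -> subgradient f x g -> norm2 g <= G.
Proof.
(* Testing at [x + g] gives [norm2 g ^+ 2 <= f (x + g) - f x <= G * norm2 g]. *)
move=> G0 lip sub; have := sub (x + g); have := lip (x + g) x.
rewrite addrAC subrr add0r -norm2_sqr => /(le_trans (ler_norm _)) h1 h2.
have [->|n0] := eqVneq (norm2 g) 0; first exact: ltW.
have np : 0 < norm2 g by rewrite lt_def n0 norm2_ge0.
by rewrite -(ler_pM2r np) -expr2; lra.
Qed.

Theorem theorem3 (R : realType) (G : R) (hG : 0 < G) :
  exists (C : R) (k : nat), 0 < C /\
  forall (d : nat), (0 < d)%N ->
  forall (T : nat), (0 < T)%N ->
  forall (u : nat -> 'rV[R]_d) (l : nat -> 'rV[R]_d -> R) (g : nat -> 'rV[R]_d),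
    admissible_env G l g T ->
    env_regret G l g T u <=
      C * polylog k T (umax T u) *
      (1 + norm2 (ubar T u) * Num.sqrt (T%:R) + Num.sqrt (path_len T u * Sbar T u)).
Proof.
(* The factor [G] undoes the normalisation of the gradients. *)
exists (G * 288), 3%N; split; first by rewrite mulr_gt0.
move=> d _ T T0 u l g env.
pose g' t := if (1 <= t <= T)%N then G^-1 *: g t else 0.
have g'1 t : norm2 (g' t) <= 1.
  rewrite /g'; case: ifP => ht; last by rewrite norm2_0.
  have [_ [lip sub]] := env t ht.
  rewrite norm2Z gtr0_norm ?invr_gt0 // mulrC ler_pdivrMr // mul1r.
  exact: subgradient_norm_le lip sub.
have g'0 t : (T < t)%N -> g' t = 0.
  by move=> ht; rewrite /g'; have -> : (0 < t <= T)%N = false by lia.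
have := anytime_linear_regret u T0 g'1 g'0.
move=> /(ler_wpM2l (ltW hG)); rewrite !mulrA => H; apply: (le_trans _ H).
rewrite mulr_sumr /env_regret big_nat [leRHS]big_nat; apply: ler_sum => t ht.
have ht' : (1 <= t <= T)%N by lia.
have [_ [lip sub]] := env t ht'.
have -> : anytime_pred 1 g' t = anytime_pred G g t.
  apply/esym/anytime_pred_scale => // [|i hi]; first by case/andP: ht.
  by rewrite /g'; have -> : (0 < i <= T)%N by lia.
rewrite /g' /padded ht' dotvZl mulrA divff ?gt_eqF // mul1r.
(* The subgradient inequality at [u t] bounds the loss difference by the linear one. *)
have := sub (u t); rewrite !dotvBr; lra.
Qed.
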